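(* There exist absolute constants $c_1>0$ and $x_0$ such that for every real $x\ge x_0$ the following holds: there exist primes $r_1,r_2,q$, pairwise distinct, with $x^{1/2}\log x< r_i\le 2x^{1/2}\log x$ for $i=1,2$ and $q\le 4x$, such that the number $r_1r_2q\in C_3$ has at least $c_1\dfrac{x}{\log^4 x}$ different $C_3$-parents of the form $p_1p_2p_3$ with primes $x<p_i\le 2x$ $(i=1,2,3)$.
   Context: For an integer $n>1$, $P(n)$ denotes the largest prime factor of $n$. Let $C_3=\{p_1p_2p_3: p_1,p_2,p_3 \text{ primes}, p_i\ne p_j \text{ for } i\ne j\}$, and let $B_3$ be the set of products $p_1p_2p_3$ of three primes in which exactly two of the primes are equal (i.e. some two coincide but not all three). Let $A_3=C_3\cup B_3$. For $n=p_1p_2p_3\in A_3$ define $w(n)=P(p_1+p_2)\,P(p_1+p_3)\,P(p_2+p_3)$ (this is independent of the ordering of the prime factors, and $w(n)\in A_3$). For $n\in A_3$, an element $m\in A_3$ with $w(m)=n$ is called a parent of $n$; if moreover $m\in C_3$ it is called a $C_3$-parent of $n$. ''Different'' parents means different integers $m$. $\log$ is the natural logarithm. *)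

(* Defs.v *)
From mathcomp Require Import all_boot.

Set Implicit Arguments.
Unset Strict Implicit.
Unset Printing Implicit Defensive.

Definition C3 (n : nat) : Prop :=
  exists p1 p2 p3 : nat,
    [/\ [/\ prime p1, prime p2 & prime p3],
        [/\ p1 != p2, p1 != p3 & p2 != p3] &
        n = p1 * p2 * p3].

(* The factors being unordered, the two equal primes may be listed first. *)
Definition B3 (n : nat) : Prop :=
  exists p1 p2 p3 : nat,
    [/\ [/\ prime p1, prime p2 & prime p3],
        p1 = p2 /\ p2 != p3 &
        n = p1 * p2 * p3].

Definition A3 (n : nat) : Prop := C3 n \/ B3 n.

(* The nondecreasing list of the prime factors of n, with multiplicity. *)
Definition prime_factors (n : nat) : seq nat := tally_seq (prime_decomp n).

(* The value 0 when n is not a product of three primes is a dummy: w is only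
   meant on A3. See w_mul3 for the value on an arbitrary ordering. *)
Definition w (n : nat) : nat :=
  if prime_factors n is [:: p1; p2; p3] then
    max_pdiv (p1 + p2) * max_pdiv (p1 + p3) * max_pdiv (p2 + p3)
  else 0.

Definition parent (n m : nat) : Prop := [/\ A3 n, A3 m & w m = n].

Definition C3_parent (n m : nat) : Prop := parent n m /\ C3 m.

Lemma perm_prime_factors (s : seq nat) :
  all prime s -> perm_eq (prime_factors (\prod_(p <- s) p)) s.
Proof.
have prod_gt0 t : all prime t -> 0 < \prod_(p <- t) p.
  elim: t => [|p t IHt] /=; first by rewrite big_nil.
  by move=> /andP[p_pr t_pr]; rewrite big_cons muln_gt0 (prime_gt0 p_pr) IHt.
have logs t p : all prime t -> prime p ->
    logn p (\prod_(q <- t) q) = count_mem p t.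
  move=> + p_pr; elim: t => [|q t IHt] /=; first by rewrite big_nil logn1.
  move=> /andP[q_pr t_pr]; rewrite big_cons.
  rewrite lognM; [|exact: prime_gt0|exact: prod_gt0].
  by rewrite IHt // logn_prime // eq_sym.
move=> s_pr; have prs : perm_eq (primes (\prod_(q <- s) q)) (undup s).
  apply: uniq_perm; rewrite ?primes_uniq ?undup_uniq // => p.
  rewrite mem_undup -logn_gt0; case p_pr: (prime p).
    by rewrite logs // -has_count has_pred1.
  rewrite lognE p_pr; apply/esym/negP => /(allP s_pr) /=.
  by rewrite p_pr.
apply: perm_trans (tallyK s); apply: perm_tally_seq.
rewrite (permPr (tallyE s)) prime_decompE (permPl (perm_map _ prs)).
rewrite (_ : map _ _ = [seq (x, count_mem x s) | x <- undup s]) //.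
apply/eq_in_map => p; rewrite mem_undup => /(allP s_pr) p_pr.
by rewrite logs.
Qed.

Lemma w_mul3 (p1 p2 p3 : nat) : prime p1 -> prime p2 -> prime p3 ->
  w (p1 * p2 * p3) =
    max_pdiv (p1 + p2) * max_pdiv (p1 + p3) * max_pdiv (p2 + p3).
Proof.
move=> pr1 pr2 pr3; have /= := @perm_prime_factors [:: p1; p2; p3].
rewrite pr1 pr2 pr3 !big_cons big_nil muln1 mulnA => /(_ isT).
rewrite /w; move: (prime_factors _) => t.
pose F s := if s is [:: a; b; c] then
  max_pdiv (a + b) * max_pdiv (a + c) * max_pdiv (b + c) else 0.
rewrite -[LHS]/(F t) -[RHS]/(F [:: p1; p2; p3]).
apply: catCA_perm_subst => {t} s1 s2 s3.
case: s1 s2 s3 => [|a [|b [|c [|? ?]]]] [|d [|e [|f [|? ?]]]] [|g [|h [|? ?]]] //=.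
- by rewrite (addnC d a) mulnAC.
- by rewrite (addnC d a) (addnC e a) mulnC mulnA.
- by rewrite (addnC d a) (addnC d b) -mulnA mulnC.
Qed.

(* Main.v *)
Require Import Defs.
From mathcomp Require Import all_boot all_order all_algebra.
From mathcomp Require Import zify ring lra.

(** Write y = x^(1/2) log x, let A be the set of primes in (x, 2x], N = #A.  If
    r1, r2 are distinct primes in (y, 2y] and r1 | p1 + p2, r2 | p1 + p3 with
    p1, p2, p3 in A, then P(p1 + p2) = r1 and P(p1 + p3) = r2 because p + p' <= 4x < y^2.
    So it suffices to find r1, r2 for which there are >> N^3 / (r1 r2) such triples:
    removing the few with r_i | p2 + p3 and applying the pigeonhole principle to
    q = P(p2 + p3), which takes O(x / log x) values, leaves x / log^4 x triples with
    the same q.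

    The triples are plentiful as soon as A is well distributed modulo r1 and r2 in
    mean square.  That this holds for most primes r in (y, 2y] is an elementary large
    sieve.  Let g_r(n) = #{p in A : p = n mod r} - N/r, V_r = sum_(n < r) g_r(n)^2 and
    T = sum_r V_r, so that T = sum_(p in A) sum_r g_r(p).  By Cauchy-Schwarz, T^2 is at
    most N sum_(n in J) (sum_r g_r(n))^2 for every interval J containing A.  For r <> r'
    the product g_r g_r' has period r r' and mean zero; its partial sums are periodic
    too, so averaging over the translates of J by s < L makes its contribution
    O(r r' N^2 / L).  The choice of L of order x log^10 x suffices, since N and the number
    of moduli are bounded below by Chebyshev's estimates. *)

Set Implicit Arguments.
Unset Strict Implicit.
Unset Printing Implicit Defensive.
Import Order.TTheory GRing.Theory Num.Theory.

(** * Chebyshev's estimates *)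

Definition primorial n := \prod_(0 <= p < n.+1 | prime p) p.

Lemma prod_primes_dvdn (s : seq nat) m :
  uniq s -> all prime s -> all (fun p => p %| m) s -> \prod_(p <- s) p %| m.
Proof.
elim: s => [|p s IHs] /=; first by rewrite big_nil dvd1n.
move=> /andP[ps us] /andP[pp prs] /andP[pm sm].
rewrite big_cons Gauss_dvd ?pm ?IHs //.
rewrite big_seq; apply: (big_ind (fun m => coprime p m)).
- by rewrite coprimen1.
- by move=> a b pa pb; rewrite coprimeMr pa.
- move=> q qs; rewrite prime_coprime // dvdn_prime2 ?(allP prs q qs) //.
  by apply: contraNN ps => /eqP ->.
Qed.

Lemma prime_dvd_fact p n : prime p -> p %| n`! -> p <= n.
Proof.
move=> pp; elim: n => [|n IHn]; first by rewrite fact0 dvdn1 => /eqP p1; rewrite p1 in pp.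
rewrite factS Euclid_dvdM // => /orP[/dvdn_leq -> //|/IHn]; exact: leqW.
Qed.

Lemma central_binS n : n.+1 * 'C(n.+1.*2, n.+1) = 2 * n.*2.+1 * 'C(n.*2, n).
Proof.
have h1 := mul_bin_diag n.+1.*2 n; have h3 := mul_bin_diag n.*2.+1 n.
have := @bin_sub n.*2.+1 n ltac:(lia); have -> : n.*2.+1 - n = n.+1 by lia.
move: h1 h3; rewrite /= doubleS /=.
set a := 'C(_, n); set b := 'C(_, n); set c := 'C(_, n.+1); set d := 'C(_, n.+1).
nia.
Qed.

Lemma central_bin_lower n : 0 < n -> 4 ^ n <= n.*2 * 'C(n.*2, n).
Proof.
elim: n => // [[|n]] IHn _ //.
have := central_binS n.+1; have := IHn isT; rewrite (expnS 4 n.+1).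
set a := 'C(_, _); set b := 'C(_, _); nia.
Qed.

Lemma central_bin_upper n : 2 * 'C(n.+1.*2, n.+1) <= 4 ^ n.+1.
Proof.
elim: n => // n IHn.
have := central_binS n.+1; rewrite (expnS 4 n.+1).
move: IHn; set a := 'C(_, _); set b := 'C(_, _); nia.
Qed.

(** Strong induction. An even n > 2 adds no prime. For n = 2m + 1, a prime in (m + 1, n] divides n!
    but neither m! nor (m + 1)!, so the product of these primes divides C(n, m) <= 4^m, while the
    primes up to m + 1 contribute at most 4^(m + 1). *)
Lemma primorial_le n : primorial n <= 4 ^ n.
Proof.
rewrite /primorial; elim/ltn_ind: n => n IHn.
have [n2|n2] := leqP n 2.
  case: n n2 {IHn} => [|[|[|//]]] _; by rewrite unlock.
have [odn|evn] := boolP (odd n); last first.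
  rewrite big_mkcond big_nat_recr //= -big_mkcond /=.
  have -> : prime n = false.
    apply/negbTE/negP => pn; case: (even_prime pn) evn => [|-> //] ?; lia.
  rewrite muln1 -(prednK (n := n)); last by lia.
  apply: leq_trans (IHn n.-1 _) _; first by lia.
  rewrite leq_exp2l //; lia.
have En := odd_double_half n; rewrite odn in En.
set m := n./2 in En.
have m0 : 0 < m by lia.
rewrite (big_cat_nat (n := m.+2)) //=; last by lia.
have -> : 4 ^ n = 4 ^ m.+1 * 4 ^ m by rewrite -expnD; congr (_ ^ _); lia.
apply: leq_mul; first by apply: IHn; lia.
(* By Pascal's rule 2 C(n, m) = C(2m + 2, m + 1), and the recurrence for central coefficients then
   gives C(n, m) <= 2 C(2m, m) <= 4^m. *)
have h : 'C(n, m) <= 4 ^ m.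
  have h1 := mul_bin_diag n m; have h2 := @bin_sub n m.+1.
  case: m m0 En h1 h2 => // k _ En h1 h2.
  have := central_bin_upper k.
  have := central_binS k.+1.
  have -> : 'C(k.+2.*2, k.+2) = 2 * 'C(n, k.+1).
    rewrite -En in h1 h2 *.
    have -> : k.+2.*2 = (true + k.+1.*2).+1 by lia.
    rewrite binS.
    have := h2 ltac:(lia).
    have -> : true + k.+1.*2 - k.+2 = k.+1 by lia.
    move=> ->; lia.
  set a := 'C(_, _); set b := 'C(_, _); nia.
apply: leq_trans h.
apply: dvdn_leq; first by rewrite bin_gt0; lia.
rewrite -big_filter; apply: prod_primes_dvdn.
- by rewrite filter_uniq // iota_uniq.
- by apply: filter_all.
apply/allP => p; rewrite mem_filter mem_index_iota => /andP[pp /andP[p1 p2]].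
have : p %| n`! by rewrite dvdn_fact //; lia.
rewrite -(@bin_fact n m); last by lia.
rewrite !Euclid_dvdM // => /orP[|/orP[]] //.
- by move/(prime_dvd_fact pp); lia.
- by move/(prime_dvd_fact pp); lia.
Qed.

(** Legendre's formula for (2n)! = C(2n, n) n! n!, written without subtraction. Both sums run over
    the same k, so that they can be compared term by term; the terms added to the sum for n vanish
    because p^k > n. *)
Lemma logn_central_bin p n : prime p ->
  logn p 'C(n.*2, n) + 2 * \sum_(1 <= k < n.*2.+1) n %/ p ^ k =
  \sum_(1 <= k < n.*2.+1) n.*2 %/ p ^ k.
Proof.
move=> pp; have := congr1 (logn p) (@bin_fact n.*2 n ltac:(lia)).
have -> : n.*2 - n = n by lia.
have b0 : 0 < 'C(n.*2, n) by rewrite bin_gt0; lia.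
rewrite !lognM ?muln_gt0 ?fact_gt0 // !logn_fact //.
have -> : \sum_(1 <= k < n.*2.+1) n %/ p ^ k = \sum_(1 <= k < n.+1) n %/ p ^ k.
  rewrite (big_cat_nat (n := n.+1)) //=; last by lia.
  rewrite [X in _ + X = _]big1_seq ?addn0 // => k /=.
  rewrite mem_index_iota => /andP[nk _]; apply: divn_small.
  by apply: leq_trans nk _; apply/ltnW/ltn_expl/prime_gt1.
lia.
Qed.

(** Each k contributes floor(2n / p^k) - 2 floor(n / p^k), which is at most 1, and 0 once p^k > 2n.
    Hence the p-part of C(2n, n) is at most 2n. *)
Lemma pfactor_central_bin p n : prime p -> 0 < n ->
  logn p 'C(n.*2, n) <= trunc_log p n.*2.
Proof.
move=> pp n0; have p1 := prime_gt1 pp.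
set t := trunc_log _ _.
have ht k : (p ^ k <= n.*2) -> k <= t by apply: trunc_log_max.
have t2n : t <= n.*2.
  apply: leq_trans (trunc_logP p1 (n := n.*2) ltac:(lia)).
  exact/ltnW/ltn_expl.
rewrite -(leq_add2r (2 * \sum_(1 <= k < n.*2.+1) n %/ p ^ k)).
rewrite logn_central_bin // big_distrr /=.
have -> : t = \sum_(1 <= k < n.*2.+1) (k <= t).
  rewrite (big_cat_nat (n := t.+1)) //=.
  rewrite [X in _ = _ + X]big1_seq ?addn0; last first.
    by move=> k /=; rewrite mem_index_iota; case: leqP => // ? /andP[]; lia.
  rewrite (eq_big_nat _ _ (F2 := fun=> 1)); last by move=> k /andP[_]; rewrite ltnS => ->.
  by rewrite sum_nat_const_nat muln1 subn1.
rewrite -big_split /=; apply: leq_sum => k _.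
have pk0 : 0 < p ^ k by rewrite expn_gt0 (ltnW p1).
have [h|h] := boolP (p ^ k <= n.*2); last by rewrite divn_small //; lia.
rewrite (ht _ h) -addnn; apply: leq_trans (leq_divDl _ _ _) _; lia.
Qed.

Lemma central_bin_prod n : 0 < n ->
  'C(n.*2, n) = \prod_(0 <= p < n.*2.+1 | prime p) p ^ logn p 'C(n.*2, n).
Proof.
move=> n0; have b0 : 0 < 'C(n.*2, n) by rewrite bin_gt0; lia.
rewrite {1}(prod_prime_decomp b0) prime_decompE big_map /=.
rewrite -[RHS]big_filter [RHS](bigID (mem (primes 'C(n.*2, n)))) /=.
rewrite [X in _ = _ * X]big1_seq ?muln1; last first.
  move=> p /andP[pC]; rewrite mem_filter => /andP[pp _].
  by rewrite (eqP (_ : logn p _ == 0)) // -leqn0 leqNgt logn_gt0.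
rewrite -[RHS]big_filter; apply: perm_big; apply: uniq_perm.
- exact: primes_uniq.
- by rewrite !filter_uniq ?iota_uniq.
move=> p; rewrite !mem_filter mem_iota.
case pC: (p \in _) => //=.
have := pC; rewrite mem_primes => /and3P[pp _ _]; rewrite pp /=.
have := pC; rewrite -logn_gt0 => l0.
have := pfactor_central_bin pp n0 => /(leq_trans l0).
rewrite trunc_log_gt0; have := prime_gt1 pp; lia.
Qed.

(** Only k = 1 survives in Legendre's formula, and there floor(2n / p) = 2 cancels against 2 floor(n
    / p) = 2. *)
Lemma pfactor_central_bin_eq0 p n : prime p -> n.*2 < p ^ 2 -> n.*2 < 3 * p ->
  p <= n -> logn p 'C(n.*2, n) = 0.
Proof.
move=> pp h2 h3 pn; have p1 := prime_gt1 pp.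
have := logn_central_bin n pp.
have E m : m < p ^ 2 -> \sum_(1 <= k < n.*2.+1) m %/ p ^ k = m %/ p.
  move=> mp; rewrite big_ltn; last by lia.
  rewrite expn1 big1_seq ?addn0 // => k /=.
  rewrite mem_index_iota => /andP[k2 _]; apply: divn_small.
  by apply: leq_trans mp _; rewrite leq_exp2l.
rewrite !E //; last by lia.
have -> : n.*2 %/ p = 2 by apply/eqP; rewrite eqn_leq -ltnS ltn_divLR ?leq_divRL; lia.
have -> : n %/ p = 1 by apply/eqP; rewrite eqn_leq -ltnS ltn_divLR ?leq_divRL; lia.
lia.
Qed.

(** The method of Erdos for Bertrand's postulate. With s of order sqrt n, taking logarithms leaves
    at least a constant times n / log n primes in (n, 2n]. *)
Lemma prime_count_lower n s : 0 < n -> n.*2 < s.+1 ^ 2 ->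
  4 ^ n <= n.*2 ^ (count (fun p => prime p && (n < p)) (iota 0 n.*2.+1) + s.+1)
           * 4 ^ (n.*2 %/ 3).
Proof.
move=> n0 ns.
apply: leq_trans (central_bin_lower n0) _.
(* One of the s + 1 factors 2n pays for the factor lost in [central_bin_lower]; the other s are for
   the primes up to s. *)
rewrite addnS expnS -mulnA leq_pmul2l; last by lia.
(* Primes p <= s or p > n contribute at most 2n each, primes in (s, 2n/3] at most p,
   and primes in (2n/3, n] nothing. *)
rewrite (central_bin_prod n0).
pose P p := (p <= s) || (n < p).
apply: leq_trans (_ : \prod_(0 <= p < n.*2.+1 | prime p)
   ((if P p then n.*2 else 1) * (if p <= n.*2 %/ 3 then p else 1)) <= _).
  apply: leq_prod => p pp; have p1 := prime_gt1 pp.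
  have b1 : p ^ logn p 'C(n.*2, n) <= n.*2.
    apply: leq_trans (trunc_logP p1 (n := n.*2) ltac:(lia)).
    by rewrite leq_exp2l // pfactor_central_bin.
  case: ifP => Pp.
    by case: ifP => _; [rewrite -[leqLHS]muln1 leq_mul //; lia | rewrite muln1].
  move/negbT: Pp; rewrite negb_or -ltnNge -leqNgt => /andP[sp pn].
  have p2 : n.*2 < p ^ 2 by apply: leq_trans ns _; rewrite leq_exp2r.
  rewrite mul1n; case: ifPn => p3; last first.
    rewrite pfactor_central_bin_eq0 //; move: p3.
    by rewrite -ltnNge ltn_divLR //; lia.
  rewrite -[leqRHS]expn1 leq_exp2l //.
  apply: leq_trans (pfactor_central_bin pp n0) _.
  rewrite leqNgt; apply/negP => h.
  have := trunc_logP p1 (n := n.*2) ltac:(lia); apply/negP; rewrite -ltnNge.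
  by apply: leq_trans p2 _; rewrite leq_exp2l.
rewrite big_split /=; apply: leq_mul; last first.
  rewrite -big_mkcondr /=.
  apply: leq_trans (primorial_le _); rewrite /primorial.
  have h : n.*2 %/ 3 <= n.*2 by apply: leq_div.
  rewrite [leqLHS](big_cat_nat (n := (n.*2 %/ 3).+1)) //=.
  rewrite [X in _ * X]big_nat_cond [X in _ * X]big1 ?muln1; last first.
    by move=> p /andP[/andP[p1 _] /andP[_ ]]; rewrite leqNgt p1.
  rewrite big_nat_cond [leqRHS]big_nat_cond.
  rewrite (eq_bigl (fun i => (0 <= i < (n.*2 %/ 3).+1) && prime i)) //.
  by move=> p; rewrite ltnS; case: (leqP p); rewrite ?andbT ?andbF.
rewrite -big_mkcondr /= big_const_seq iter_muln_1 leq_pexp2l //; first by lia.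
rewrite -(addn0 (count _ _)) /index_iota subn0.
set r := iota 0 _.
rewrite (eq_count (a2 := predU (fun p => prime p && (n < p))
   (fun p => prime p && (p <= s)))); last first.
  by move=> p /=; rewrite -andb_orr orbC.
rewrite addn0; apply: leq_trans (_ : count (fun p => prime p && (n < p)) r +
  count (fun p => prime p && (p <= s)) r <= _).
  by rewrite -count_predUI leq_addr.
rewrite leq_add2l -size_filter -[leqRHS](size_iota 1).
apply: uniq_leq_size; first by rewrite filter_uniq ?iota_uniq.
move=> p; rewrite mem_filter mem_iota => /andP[/andP[/prime_gt0 ? ?] _]; lia.
Qed.

(** At least pi(m) - k primes lie in [k, m], and each contributes a factor of at least k to the
    primorial. *)
Lemma prime_count_upper m k : 0 < k -> k ^ (count prime (iota 0 m.+1) - k) <= 4 ^ m.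
Proof.
move=> k0; apply: leq_trans (primorial_le m).
apply: leq_trans (_ : k ^ count (fun p => prime p && (k <= p)) (iota 0 m.+1) <= _).
  rewrite leq_pexp2l // leq_subLR addnC.
  rewrite (eq_count (a2 := predU (fun p => prime p && (k <= p))
    (fun p => prime p && (p < k)))); last first.
    by move=> p /=; rewrite -andb_orr ltnNge orbN andbT.
  apply: leq_trans (_ : count (fun p => prime p && (k <= p)) (iota 0 m.+1) +
    count (fun p => prime p && (p < k)) (iota 0 m.+1) <= _).
    by rewrite -count_predUI leq_addr.
  rewrite leq_add2l -size_filter -[leqRHS](size_iota 0).
  apply: uniq_leq_size; first by rewrite filter_uniq ?iota_uniq.
  by move=> p; rewrite !mem_filter !mem_iota add0n => /andP[/andP[_ ->]].
rewrite /primorial /index_iota subn0.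
rewrite [leqRHS](bigID (leq k)) -[leqLHS]muln1; apply: leq_mul; last first.
  by apply: prodn_cond_gt0 => p /andP[/prime_gt0].
rewrite -[leqLHS]muln1 -iter_muln -big_const_seq.
by apply: leq_prod => p /andP[_].
Qed.

(** * From divisor triples to parents *)

(** The cofactor n / r is less than r, so it has no prime divisor as large as r. *)
Lemma max_pdiv_large_prime r n : prime r -> r %| n -> 0 < n < r ^ 2 -> max_pdiv n = r.
Proof.
move=> pr rn /andP[n0 nr]; have r1 := prime_gt1 pr.
have n1 : 1 < n by apply: leq_trans r1 (dvdn_leq n0 rn).
have rm : r <= max_pdiv n by apply: max_pdiv_max; rewrite mem_primes pr n0.
have := max_pdiv_dvd n; rewrite -{2}(divnK rn) Euclid_dvdM ?max_pdiv_prime //.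
case/orP => [h|]; last by rewrite dvdn_prime2 ?max_pdiv_prime // => /eqP.
have k0 : 0 < n %/ r by rewrite divn_gt0 ?prime_gt0 // dvdn_leq.
have := leq_trans rm (dvdn_leq k0 h); rewrite leqNgt ltn_divLR ?prime_gt0 //.
by rewrite mulnn nr.
Qed.

(** Pigeonhole principle, used both to find a frequent value q and to pass from triples to distinct
    products. *)
Lemma size_le_fibers (T : Type) (F : seq T) (f : T -> nat) (Q : seq nat) M :
  uniq Q -> all (fun t => f t \in Q) F ->
  {in Q, forall q, count (fun t => f t == q) F <= M} -> size F <= M * size Q.
Proof.
move=> uQ FQ FM.
have -> : size F = \sum_(q <- Q) count (fun t => f t == q) F.
  under eq_bigr => q _ do rewrite -sum1_count big_mkcond.
  rewrite exchange_big /= -sum1_size.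
  elim: F FQ {FM} => [|t F IH] /=; first by rewrite !big_nil.
  move=> /andP[tQ FQ]; rewrite !big_cons IH //; congr (_ + _).
  rewrite (bigD1_seq (f t)) //= eqxx big1 // => q.
  by rewrite eq_sym => /negbTE ->.
apply: leq_trans (_ : \sum_(q <- Q) M <= _); last first.
  by rewrite big_const_seq count_predT iter_addn_0.
by rewrite big_seq [leqRHS]big_seq; apply: leq_sum.
Qed.

Definition divisor_triples (A : seq nat) (r1 r2 : nat) : seq (nat * nat * nat) :=
  [seq t <- [seq (p, p3) | p <- [seq (p1, p2) | p1 <- A, p2 <- A], p3 <- A]
     | (r1 %| t.1.1 + t.1.2) && (r2 %| t.1.1 + t.2)].

Definition oppcount (A : seq nat) r n := count (fun p => r %| n + p) A.

(** Once p1 is fixed, the conditions on p2 and p3 are independent. *)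
Lemma size_divisor_triples A r1 r2 :
  size (divisor_triples A r1 r2) = \sum_(p <- A) oppcount A r1 p * oppcount A r2 p.
Proof.
rewrite size_filter -sum1_count big_mkcond big_allpairs big_allpairs /=.
apply: eq_bigr => p1 _; rewrite /oppcount -!sum1_count big_distrl /= [RHS]big_mkcond.
apply: eq_bigr => p2 _; case: ifP => r12 /=; last by rewrite big1.
by rewrite mul1n -big_mkcond.
Qed.

Lemma mem_divisor_triples A r1 r2 p1 p2 p3 :
  ((p1, p2, p3) \in divisor_triples A r1 r2) =
  [&& p1 \in A, p2 \in A, p3 \in A, r1 %| p1 + p2 & r2 %| p1 + p3].
Proof.
rewrite mem_filter /= andbC.
have -> : ((p1, p2, p3) \in [seq (p, p3) | p <- [seq (p1, p2) | p1 <- A, p2 <- A], p3 <- A])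
  = [&& p1 \in A, p2 \in A & p3 \in A].
  apply/allpairsP/and3P => [[[[a b] c] /= [/allpairsP[[d e] /= [dA eA [-> ->]]] cA [-> -> ->]]] //|[a b c]].
  by exists ((p1, p2), p3); split => //; apply/allpairsP; exists (p1, p2).
by rewrite !andbA.
Qed.

Lemma uniq_divisor_triples A r1 r2 : uniq A -> uniq (divisor_triples A r1 r2).
Proof.
move=> uA; apply: filter_uniq; apply: allpairs_uniq => //; last by move=> [? ?] [? ?] _ _ /= [-> ->].
by apply: allpairs_uniq => // [[? ?] [? ?] _ _ /= [-> ->]].
Qed.

(** Elements of one residue class modulo r are separated by their quotients by r, which are at most
    X / r. *)
Lemma oppcount_le A r n X : 0 < r -> uniq A -> {in A, forall p, p < X} ->
  oppcount A r n <= (X %/ r).+1.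
Proof.
move=> r0 uA AX; rewrite /oppcount -size_filter -(size_map (fun p => p %/ r)).
rewrite -[leqRHS](size_iota 0); apply: uniq_leq_size.
  rewrite map_inj_in_uniq ?filter_uniq // => a b.
  rewrite !mem_filter => /andP[ra _] /andP[rb _] ab.
  rewrite (divn_eq a r) (divn_eq b r) ab; congr (_ + _); apply/eqP.
  by rewrite -(eqn_modDl n) (eqP ra) (eqP rb).
move=> q /mapP[p]; rewrite mem_filter => /andP[_ /AX pX] ->.
by rewrite mem_iota add0n ltnS /= leq_div2r // ltnW.
Qed.

Section Triples.
Variables (A : seq nat) (r1 r2 X : nat).
Hypotheses (uA : uniq A) (prA : {in A, forall p, prime p}).
Hypotheses (pr1 : prime r1) (pr2 : prime r2) (r12 : r1 != r2).
Hypotheses (r1_odd : 2 < r1) (r2_odd : 2 < r2).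
Hypotheses (rA : {in A, forall p, maxn r1 r2 < p}).
Hypothesis AX : {in A, forall p, p.*2 < X}.
Hypotheses (X1 : X <= r1 ^ 2) (X2 : X <= r2 ^ 2) (X12 : X <= r1 * r2).

Let co12 : coprime r1 r2.
Proof. by rewrite prime_coprime // dvdn_prime2. Qed.

Let AX' : {in A, forall p, p < X}.
Proof. by move=> p /AX; lia. Qed.

Let sum_bounds a b : a \in A -> b \in A -> 0 < a + b < X.
Proof. by move=> aA bA; have := AX aA; have := AX bA; have := prime_gt0 (prA aA); lia. Qed.

Lemma double_not_dvd r p : prime r -> 2 < r -> maxn r1 r2 < p ->
  r <= maxn r1 r2 -> prime p -> ~~ (r %| p + p).
Proof.
move=> pr r_gt2 rp rr pp; rewrite addnn -muln2 Euclid_dvdM // negb_or !dvdn_prime2 //.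
by apply/andP; split; apply/negP => /eqP; lia.
Qed.

(** If p1 equals p2 or p3, then r1 or r2 divides 2 p1, impossible for an odd prime below p1. If p2 =
    p3, then r1 r2 divides p1 + p2 < X <= r1 r2. *)
Lemma divisor_triple_uniq p1 p2 p3 :
  (p1, p2, p3) \in divisor_triples A r1 r2 -> [/\ p1 != p2, p1 != p3 & p2 != p3].
Proof.
rewrite mem_divisor_triples => /and5P[p1A p2A p3A d1 d2]; split.
- apply/negP => /eqP E; have := double_not_dvd pr1 r1_odd (rA p1A) (leq_maxl _ _) (prA p1A).
  by rewrite {2}E d1.
- apply/negP => /eqP E; have := double_not_dvd pr2 r2_odd (rA p1A) (leq_maxr _ _) (prA p1A).
  by rewrite {2}E d2.
- apply/negP => /eqP E; rewrite -E in d2.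
  have : r1 * r2 %| p1 + p2 by rewrite Gauss_dvd // d1.
  have := AX p1A; have := AX p2A; have := prime_gt0 (prA p1A) => ? ? ? /dvdn_leq; lia.
Qed.

Let bad := [seq t <- divisor_triples A r1 r2 | (r1 %| t.1.2 + t.2) || (r2 %| t.1.2 + t.2)].

Lemma eq_mod12 a b : a \in A -> b \in A -> a = b %[mod r1] -> a = b %[mod r2] -> a = b.
Proof.
move=> aA bA /eqP h1 /eqP h2; have := chinese_remainder co12 a b.
rewrite h1 h2 /= => /eqP; have := AX' aA; have := AX' bA => aX bX.
by rewrite !modn_small //; lia.
Qed.

Lemma modn_opp_eq r a b c : r %| a + b -> r %| a + c -> b = c %[mod r].
Proof.
move=> ab ac; apply/eqP; rewrite -(eqn_modDl a); apply/eqP.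
by rewrite (eqP ab) (eqP ac).
Qed.

(** Bad triples are those for which P(p2 + p3) might be r1 or r2. If r1 divides p2 + p3, then p3 is
    fixed modulo r1 by p2 and modulo r2 by p1, hence fixed, since it is below X <= r1 r2. So these
    triples inject into the pairs with r1 | p1 + p2; for r2 the roles of p2 and p3 are exchanged. *)
Lemma size_bad_triples :
  size bad <= size A * (X %/ r1).+1 + size A * (X %/ r2).+1.
Proof.
pose pairs r := [seq t <- [seq (p, p') | p <- A, p' <- A] | r %| t.1 + t.2].
have mp r a b : ((a, b) \in pairs r) = [&& r %| a + b, a \in A & b \in A].
  rewrite mem_filter /=; congr (_ && _).
  apply/allpairsP/andP => [[[c d] /= [cA dA [-> ->]]] //|[aA bA]].
  by exists (a, b).
have sp r : 0 < r -> size (pairs r) <= size A * (X %/ r).+1.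
  move=> r0; rewrite size_filter -sum1_count big_mkcond big_allpairs /=.
  apply: leq_trans (_ : \sum_(p <- A) (X %/ r).+1 <= _); last first.
    by rewrite big_const_seq count_predT iter_addn_0 mulnC.
  apply: leq_sum => p _; rewrite -big_mkcond sum1_count; exact: oppcount_le.
rewrite size_filter.
apply: leq_trans (_ : count (fun t => r1 %| t.1.2 + t.2) (divisor_triples A r1 r2) +
   count (fun t => r2 %| t.1.2 + t.2) (divisor_triples A r1 r2) <= _).
  by rewrite -count_predUI leq_addr.
apply: leq_add.
- apply: leq_trans (sp r1 (prime_gt0 pr1)).
  rewrite -size_filter -(size_map fst); apply: uniq_leq_size.
    rewrite map_inj_in_uniq; first exact/filter_uniq/uniq_divisor_triples.
    move=> [[a b] c] [[a' b'] c']; rewrite mem_filter => /andP[/= h1].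
    rewrite mem_divisor_triples => /and5P[aA bA cA d1 d2].
    rewrite mem_filter => /andP[/= h1'].
    rewrite mem_divisor_triples => /and5P[aA' bA' cA' d1' d2'] [E1 E2].
    subst a' b'; congr (_, _); apply: eq_mod12 => //.
    + exact: modn_opp_eq h1 h1'.
    + exact: modn_opp_eq d2 d2'.
  move=> [a b] /mapP[[[a' b'] c]]; rewrite mem_filter mem_divisor_triples mp /=.
  by move=> /andP[_ /and5P[aA bA _ d1 _]] [-> ->]; rewrite d1 aA.
- apply: leq_trans (sp r2 (prime_gt0 pr2)).
  rewrite -size_filter -(size_map (fun t => (t.1.1, t.2))); apply: uniq_leq_size.
    rewrite map_inj_in_uniq; first exact/filter_uniq/uniq_divisor_triples.
    move=> [[a b] c] [[a' b'] c']; rewrite mem_filter => /andP[/= h1].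
    rewrite mem_divisor_triples => /and5P[aA bA cA d1 d2].
    rewrite mem_filter => /andP[/= h1'].
    rewrite mem_divisor_triples => /and5P[aA' bA' cA' d1' d2'] [E1 E2].
    subst a' c'; congr (_, _, _); apply: eq_mod12 => //.
    + exact: modn_opp_eq d1 d1'.
    + by rewrite addnC in h1; rewrite addnC in h1'; exact: modn_opp_eq h1 h1'.
  move=> [a b] /mapP[[[a' b'] c]]; rewrite mem_filter mem_divisor_triples mp /=.
  by move=> /andP[_ /and5P[aA _ cA _ d1]] [-> ->]; rewrite d1 aA.
Qed.

(** Such an n has exactly three prime divisors, and each of the three coordinates must be one of
    them: 27 = 3^3. *)
Lemma triple_fiber_le n (F : seq (nat * nat * nat)) : uniq F ->
  {subset F <= divisor_triples A r1 r2} ->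
  count (fun t => t.1.1 * t.1.2 * t.2 == n) F <= 27.
Proof.
move=> uF FT; rewrite -size_filter; set G := seq.filter _ _.
case E : G => [//|t0 G'].
have : t0 \in G by rewrite E mem_head.
rewrite -E {E G'} mem_filter => /andP[]; case: t0 => [[p1 p2] p3] /= /eqP En /FT h.
have [n12 n13 n23] := divisor_triple_uniq h.
move: h; rewrite mem_divisor_triples => /and5P[p1A p2A p3A _ _].
have sz : size (primes n) = 3.
  rewrite -[3]/(size [:: p1; p2; p3]); apply: perm_size; apply: uniq_perm.
  - exact: primes_uniq.
  - by rewrite /= !inE negb_or n12 n13 n23.
  have [q1 q2 q3] : [/\ prime p1, prime p2 & prime p3] by rewrite !prA.
  move=> p; rewrite mem_primes !inE -En !muln_gt0 (prime_gt0 q1) (prime_gt0 q2) (prime_gt0 q3) /=.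
  case pp: (prime p) => /=.
    by rewrite !(Euclid_dvdM _ _ pp) !(dvdn_prime2 pp) // -orbA.
  by apply/esym/negP => /or3P[] /eqP E; move: pp; rewrite E ?q1 ?q2 ?q3.
have -> : 27 = size [seq (p, p3) | p <- [seq (p1, p2) | p1 <- primes n, p2 <- primes n], p3 <- primes n].
  by rewrite !size_allpairs sz.
apply: uniq_leq_size; first exact: filter_uniq.
move=> [[a b] c]; rewrite mem_filter /= => /andP[/eqP Eabc /FT].
rewrite mem_divisor_triples => /and5P[aA bA cA _ _].
have n0 : 0 < n by rewrite -Eabc !muln_gt0 !prime_gt0 ?prA.
have mpn q : q \in A -> q %| n -> q \in primes n by move=> qA qn; rewrite mem_primes prA // n0 qn.
apply/allpairsP; exists ((a, b), c); split => //=; last first.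
  by apply: mpn => //; rewrite -Eabc dvdn_mull.
apply/allpairsP; exists (a, b); split => //=; apply: mpn => //; rewrite -Eabc.
- by rewrite -mulnA dvdn_mulr.
- by rewrite mulnAC dvdn_mull.
Qed.

(** Dropping the bad triples makes q = P(p2 + p3) differ from r1 and r2. The factor [size Qs] pays
    for fixing a frequent q, and 27 for triples with the same product. *)
Lemma many_parents (Qs : seq nat) m : uniq Qs ->
  {in A &, forall p p', max_pdiv (p + p') \in Qs} ->
  27 * m * size Qs + (size A * (X %/ r1).+1 + size A * (X %/ r2).+1)
    < size (divisor_triples A r1 r2) ->
  exists q (S : seq nat), [/\ q \in Qs, prime q, r1 != q, r2 != q &
   [/\ uniq S, m < size S & {in S, forall n, w n = r1 * r2 * q /\
     exists p1 p2 p3, [/\ [/\ p1 \in A, p2 \in A & p3 \in A],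
       [/\ p1 != p2, p1 != p3 & p2 != p3] & n = p1 * p2 * p3]}]].
Proof.
move=> uQ AQ hm.
pose good := [seq t <- divisor_triples A r1 r2 | ~~ ((r1 %| t.1.2 + t.2) || (r2 %| t.1.2 + t.2))].
have sg : 27 * m * size Qs < size good.
  have := size_bad_triples; have : size bad + size good = size (divisor_triples A r1 r2).
    by rewrite 2!size_filter count_predC.
  lia.
pose f (t : nat * nat * nat) := max_pdiv (t.1.2 + t.2).
have [q qQ hq] : exists2 q, q \in Qs & 27 * m < count (fun t => f t == q) good.
  have [/hasP[q qQ hq]|/hasPn no] := boolP (has (fun q => 27 * m < count (fun t => f t == q) good) Qs).
    by exists q.
  move: sg; rewrite ltnNge (size_le_fibers (f := f)) //.
    apply/allP => [[[p1 p2] p3]]; rewrite mem_filter mem_divisor_triples.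
    by move=> /andP[_ /and5P[? ? ? _ _]]; exact: AQ.
  by move=> q /no; rewrite -leqNgt.
pose F := [seq t <- good | f t == q].
have uF : uniq F by do 2 apply: filter_uniq; exact: uniq_divisor_triples.
have FT : {subset F <= divisor_triples A r1 r2}.
  by move=> t; rewrite mem_filter => /andP[_]; rewrite mem_filter => /andP[].
pose prd (t : nat * nat * nat) := t.1.1 * t.1.2 * t.2.
pose S := undup (map prd F).
have Fp p1 p2 p3 : (p1, p2, p3) \in F -> [/\ prime q, r1 != q, r2 != q &
     w (p1 * p2 * p3) = r1 * r2 * q /\ [/\ p1 \in A, p2 \in A & p3 \in A]].
  rewrite mem_filter => /andP[/= /eqP <-]; rewrite mem_filter negb_or /=.
  move=> /andP[/andP[d1' d2']]; rewrite mem_divisor_triples => /and5P[p1A p2A p3A d1 d2].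
  have g23 : 1 < p2 + p3 by apply: leq_trans (prime_gt1 (prA p2A)) (leq_addr _ _).
  split.
  - exact: max_pdiv_prime.
  - by apply: contraNneq d1' => ->; exact: max_pdiv_dvd.
  - by apply: contraNneq d2' => ->; exact: max_pdiv_dvd.
  split => //; rewrite w_mul3 ?prA //; congr (_ * _ * _).
  - apply: max_pdiv_large_prime => //; have /andP[-> h] := sum_bounds p1A p2A; exact: leq_trans h X1.
  - apply: max_pdiv_large_prime => //; have /andP[-> h] := sum_bounds p1A p3A; exact: leq_trans h X2.
have sF : 27 * m < size F by rewrite size_filter.
have sS : m < size S.
  have : size F <= 27 * size S.
    apply: (size_le_fibers (f := prd)); first exact: undup_uniq.
      by apply/allP => t tF; rewrite mem_undup map_f.
    by move=> n _; exact: triple_fiber_le.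
  lia.
(* One actual triple is needed to see that q is prime and differs from r1 and r2. *)
have [[[a b] c] tF] : exists t, t \in F.
  by case: (F) sF => // t F' _; exists t; rewrite mem_head.
have [pq q1 q2 _] := Fp _ _ _ tF.
exists q, S; split => //; split => //; first exact: undup_uniq.
move=> n; rewrite mem_undup => /mapP[[[p1 p2] p3] pF ->].
have [_ _ _ [wn pA]] := Fp _ _ _ pF; split => //.
by exists p1, p2, p3; split => //; exact: divisor_triple_uniq (FT _ pF).
Qed.

End Triples.

Local Open Scope ring_scope.

(** * An elementary large sieve *)

Definition periodic (T : Type) (Q : nat) (f : nat -> T) := forall n, f (n + Q)%N = f n.

Section Periodic.
Variables (V : zmodType) (Q : nat) (f : nat -> V).
Hypothesis per : periodic Q f.

Lemma periodic_addM k n : f (n + k * Q)%N = f n.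
Proof. by elim: k => [|k IHk]; rewrite ?addn0 // mulSn addnCA addnC per. Qed.

Lemma periodic_mod n : f (n %% Q)%N = f n.
Proof. by rewrite {2}(divn_eq n Q) addnC periodic_addM. Qed.

Lemma sum_periodic_shift a :
  \sum_(0 <= i < Q) f (a + i)%N = \sum_(0 <= i < Q) f i.
Proof.
elim: a => [|a <-]; first by apply: eq_bigr.
have := big_nat_recl Q 0 (fun i => f (a + i)%N) (leq0n _) (op := +%R) (idx := 0).
rewrite big_nat_recr //= per addn0 addrC => /addrI ->.
by apply: eq_bigr => i _; rewrite addSnnS.
Qed.

Lemma sum_periodic_blocks a k t :
  \sum_(0 <= i < k * Q + t) f (a + i)%N =
  (\sum_(0 <= i < Q) f i) *+ k + \sum_(0 <= i < t) f (a + i)%N.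
Proof.
elim: k => [|k IHk]; first by rewrite mulr0n add0r.
rewrite mulSn -addnA (big_cat_nat (n := Q)) ?leq_addr //= sum_periodic_shift.
rewrite mulrS -addrA -IHk; congr (_ + _).
rewrite -{1}[Q]add0n big_addn addKn; apply: eq_bigr => i _.
by rewrite addnA per.
Qed.

End Periodic.

Lemma sum_mul_blocks (V : zmodType) (F : nat -> V) m r :
  \sum_(0 <= n < m * r) F n = \sum_(0 <= j < m) \sum_(0 <= i < r) F (j * r + i)%N.
Proof.
elim: m => [|m IHm]; first by rewrite mul0n !big_nil.
rewrite big_nat_recr //= -IHm mulSnr (big_cat_nat (n := (m * r)%N)) ?leq_addr //=.
congr (_ + _); rewrite -{1}[(m * r)%N]add0n big_addn addKn.
by apply: eq_bigr => i _; rewrite addnC.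
Qed.

Lemma modn_mulr_inj Q r : coprime r Q ->
  {in index_iota 0 Q &, injective (fun j => j * r %% Q)%N}.
Proof.
move=> co a b; rewrite !mem_index_iota /=.
wlog ab : a b / (b <= a)%N => [W aQ bQ|aQ bQ /eqP].
  by case: (leqP b a) => [/W|/ltnW/W] // H; [exact: H|move=> /esym/H ->].
rewrite eqn_mod_dvd ?leq_mul // -mulnBl Gauss_dvdl 1?coprime_sym //.
by case: (posnP (a - b)) => [|ab0 /dvdn_leq] /=; lia.
Qed.

(** Since r is invertible modulo Q, the map j -> j r + i permutes the residues modulo Q. *)
Lemma sum_periodic_affine (V : zmodType) (f : nat -> V) Q r i :
  periodic Q f -> coprime r Q ->
  \sum_(0 <= j < Q) f (j * r + i)%N = \sum_(0 <= j < Q) f j.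
Proof.
move=> per co; case: (posnP Q) => [->|Q0]; first by rewrite !big_nil.
rewrite -(sum_periodic_shift per i).
have E : perm_eq [seq (j * r %% Q)%N | j <- index_iota 0 Q] (index_iota 0 Q).
  apply: uniq_perm; last 1 first.
  - apply: (uniq_min_size _ _ _).2.
    + by rewrite map_inj_in_uniq ?iota_uniq //; apply: modn_mulr_inj.
    + move=> x /mapP[j _ ->]; rewrite mem_index_iota /=; exact: ltn_pmod.
    + by rewrite size_map.
  - by rewrite map_inj_in_uniq ?iota_uniq //; apply: modn_mulr_inj.
  - exact: iota_uniq.
rewrite -[RHS](perm_big _ E) big_map /=; apply: eq_bigr => j _.
by rewrite -(periodic_mod per) -(periodic_mod per (i + _)) modnDmr addnC.
Qed.

(** Write n = j r + i with i < r: then f(n) depends on i only, and for fixed i the numbers j r + i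
    run through all residues modulo r'. *)
Lemma sum_periodic_crt (F : comPzRingType) (f k : nat -> F) r r' :
  periodic r f -> periodic r' k -> coprime r r' ->
  \sum_(0 <= n < r' * r) f n * k n =
  (\sum_(0 <= n < r) f n) * (\sum_(0 <= n < r') k n).
Proof.
move=> pf pk co; rewrite sum_mul_blocks exchange_big /= mulr_suml.
apply: eq_bigr => i _; rewrite -(sum_periodic_affine i pk co) mulr_sumr.
by apply: eq_bigr => j _; rewrite addnC periodic_addM // addnC.
Qed.

Section Ordered.
Variable R : realFieldType.
Implicit Types (f g h : nat -> R).

(** As f is nonnegative, the incomplete last period can be replaced by a complete one. *)
Lemma sum_periodic_le f Q a L : (0 < Q)%N -> periodic Q f -> (forall n, 0 <= f n) ->
  \sum_(0 <= i < L) f (a + i)%N <= (L %/ Q).+1%:R * \sum_(0 <= i < Q) f i.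
Proof.
move=> Q0 per f0; rewrite {1}(divn_eq L Q) sum_periodic_blocks //.
rewrite -natr1 mulrDl mul1r mulr_natl lerD2l -(sum_periodic_shift per a).
rewrite [leRHS](big_cat_nat (n := (L %% Q)%N)) //=; last by rewrite ltnW ?ltn_pmod.
by rewrite lerDl sumr_ge0.
Qed.

(** Lengthening the sum by a period adds the mean, which is zero. This is the source of all the
    cancellation in the sieve. *)
Lemma periodic_partial_sum h Q : periodic Q h -> \sum_(0 <= n < Q) h n = 0 ->
  periodic Q (fun e => \sum_(0 <= n < e) h n).
Proof.
move=> per h0 e /=; rewrite (big_cat_nat (n := e)) ?leq_addr //=.
rewrite -{2}[e]add0n big_addn addKn -[RHS]addr0; congr (_ + _).
rewrite -[RHS]h0 -[RHS](sum_periodic_shift per e).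
by apply: eq_bigr => i _; rewrite addnC.
Qed.

Lemma partial_sum_le h Q e : (0 < Q)%N -> periodic Q h ->
  \sum_(0 <= n < Q) h n = 0 ->
  `|\sum_(0 <= n < e) h n| <= \sum_(0 <= n < Q) `|h n|.
Proof.
move=> Q0 per h0.
rewrite -(periodic_mod (periodic_partial_sum per h0)).
apply: le_trans (ler_norm_sum _ _ _) _.
rewrite [leRHS](big_cat_nat (n := (e %% Q)%N)) //=; last by rewrite ltnW ?ltn_pmod.
by rewrite lerDl sumr_ge0.
Qed.

(** The complete periods in the two windows cancel, leaving two remainders of fewer than Q terms
    each. *)
Lemma sum_shift_diff_le f Q B a b L : (0 < Q)%N -> periodic Q f ->
  (forall n, `|f n| <= B) ->
  \sum_(0 <= s < L) f (b + s)%N - \sum_(0 <= s < L) f (a + s)%N <= 2 * Q%:R * B.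
Proof.
move=> Q0 per fB.
rewrite (divn_eq L Q) !sum_periodic_blocks // opprD addrACA subrr add0r.
have B0 : 0 <= B by apply: le_trans (fB 0).
have H c : `|\sum_(0 <= i < L %% Q) f (c + i)%N| <= Q%:R * B.
  apply: le_trans (ler_norm_sum _ _ _) _.
  apply: le_trans (ler_sum _ (fun i _ => fB (c + i)%N)) _.
  rewrite sumr_const_nat subn0 -[B *+ _]mulr_natl ler_wpM2r // ler_nat.
  by rewrite ltnW ?ltn_pmod.
apply: le_trans (ler_norm _) _; apply: le_trans (ler_normB _ _) _.
by rewrite -mulrA mulr_natl mulr2n lerD.
Qed.

(** A window sum of h is a difference of two values of its partial sum function H, which is periodic
    and bounded. Summed over the shifts s, these differences cancel up to a bound independent of L
    and W. *)
Lemma averaged_window_le h Q a W L : (0 < Q)%N -> periodic Q h ->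
  \sum_(0 <= n < Q) h n = 0 ->
  \sum_(0 <= s < L) \sum_(0 <= i < W) h (a + s + i)%N <=
  2 * Q%:R * \sum_(0 <= n < Q) `|h n|.
Proof.
move=> Q0 per h0; pose H e := \sum_(0 <= n < e) h n.
have perH : periodic Q H := periodic_partial_sum per h0.
have E s : \sum_(0 <= i < W) h (a + s + i)%N = H (a + W + s)%N - H (a + s)%N.
  rewrite /H [in RHS](big_cat_nat (n := (a + s)%N) (p := (a + W + s)%N)) //=; last by lia.
  rewrite [RHS]addrC addKr -{2}[(a + s)%N]add0n big_addn.
  have -> : (a + W + s - (a + s) = W)%N by lia.
  by apply: eq_bigr => i _; rewrite addnC.
rewrite (eq_bigr _ (fun s _ => E s)) sumrB.
apply: sum_shift_diff_le => // n; exact: partial_sum_le.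
Qed.

(** Cauchy-Schwarz, by expanding the nonnegative sum of (N u_p - S)^2. *)
Lemma sqr_sum_le (A : seq nat) (u : nat -> R) :
  (\sum_(p <- A) u p) ^+ 2 <= (size A)%:R * \sum_(p <- A) u p ^+ 2.
Proof.
have [->|A0] := eqVneq A [::]; first by rewrite !big_nil expr0n mulr0.
have N0 : 0 < (size A)%:R :> R by rewrite ltr0n lt0n size_eq0.
set N := (size A)%:R in N0 *; set S := \sum_(p <- A) u p.
have : 0 <= \sum_(p <- A) (N * u p - S) ^+ 2 by apply: sumr_ge0 => p _; exact: sqr_ge0.
have -> : \sum_(p <- A) (N * u p - S) ^+ 2 =
    N * (N * \sum_(p <- A) u p ^+ 2 - S ^+ 2).
  under eq_bigr => p _.
    have -> : (N * u p - S) ^+ 2 = N ^+ 2 * u p ^+ 2 - (2 * N * S) * u p + S ^+ 2 by ring.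
    over.
  rewrite big_split sumrB /=.
  have -> : \sum_(p <- A) S ^+ 2 = N * S ^+ 2.
    by rewrite big_const_seq count_predT iter_addr_0 mulr_natl.
  rewrite -[X in X - _ + _]mulr_sumr -[X in _ - X + _]mulr_sumr -/S; ring.
by rewrite pmulr_rge0 // subr_ge0.
Qed.

Lemma sum_subset_le (A B : seq nat) (F : nat -> R) : uniq A ->
  {subset A <= B} -> (forall n, 0 <= F n) -> uniq B ->
  \sum_(n <- A) F n <= \sum_(n <- B) F n.
Proof.
move=> uA AB F0 uB.
have E : perm_eq A [seq n <- B | n \in A].
  apply: uniq_perm => //; first by rewrite filter_uniq.
  by move=> n; rewrite mem_filter; case nA: (n \in A) => //=; rewrite AB.
rewrite (perm_big _ E) big_filter [leRHS](bigID (mem A)) /= lerDl.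
by apply: sumr_ge0.
Qed.

(** After Cauchy-Schwarz and the enlargement of A to windows of length L + X, the square of sum_r
    g_r is expanded. The pairs r = r' give the term with T; the pairs r <> r' give the last term,
    which does not grow with L. *)
Lemma large_sieve (g : nat -> nat -> R) (M : R) (A rs : seq nat) (L X d D : nat) :
  uniq A -> {in A, forall p, p < X}%N ->
  uniq rs -> {in rs &, forall r r', r != r' -> coprime r r'} -> (0 < d)%N ->
  {in rs, forall r, d <= r <= D}%N ->
  {in rs, forall r, periodic r (g r)} ->
  {in rs, forall r, \sum_(0 <= n < r) g r n = 0} ->
  {in rs, forall r, \sum_(0 <= n < r) `|g r n| <= M} ->
  let T := \sum_(r <- rs) \sum_(0 <= n < r) g r n ^+ 2 in
  \sum_(p <- A) \sum_(r <- rs) g r p = T ->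
  L%:R * T ^+ 2 <= (size A)%:R *
    (L%:R * ((L + X) %/ d).+1%:R * T + (size rs)%:R ^+ 2 * (2 * D%:R ^+ 2 * M ^+ 2)).
Proof.
move=> uA AX urs co d0 rsd per mean0 gM T ET.
(* Translating by a common multiple of the moduli makes room on the left of A:
   the window of length L + X starting at c - L + s contains c + A for all s < L. *)
pose c := (L * \prod_(r <- rs) r)%N.
have perc r n : r \in rs -> g r (n + c)%N = g r n.
  move=> rrs; rewrite /c (big_rem r) //= mulnCA mulnC.
  by apply: periodic_addM; apply: per.
have Lc : (L <= c)%N.
  rewrite leq_pmulr // big_seq; elim/big_ind: _ => // [m n|r /rsd]; first by rewrite muln_gt0 => -> ->.
  by move=> /andP[+ _]; apply: leq_trans.
pose G n := \sum_(r <- rs) g r n.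
have bound s : (s < L)%N ->
    \sum_(p <- A) G p ^+ 2 <= \sum_(0 <= i < L + X) G (c - L + s + i)%N ^+ 2.
  move=> sL.
  have -> : \sum_(p <- A) G p ^+ 2 = \sum_(n <- map (addn^~ (L - s)%N) A) G (c - L + s + n)%N ^+ 2.
    rewrite big_map; apply: eq_bigr => p _; congr (_ ^+ 2).
    have -> : (c - L + s + (p + (L - s)) = p + c)%N by lia.
    by rewrite /G big_seq [RHS]big_seq; apply: eq_bigr => r rrs; rewrite perc.
  apply: sum_subset_le.
  - by rewrite map_inj_uniq // => a b /eqP; rewrite eqn_add2r => /eqP.
  - move=> n /mapP[p /AX pX ->]; rewrite mem_index_iota; lia.
  - by move=> n; exact: sqr_ge0.
  - exact: iota_uniq.
pose C : R := L%:R * ((L + X) %/ d).+1%:R.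
pose V r := \sum_(0 <= n < r) g r n ^+ 2.
pose E : R := 2 * D%:R ^+ 2 * M ^+ 2.
(* E is allowed on the diagonal as well, so that the double sum is simply at most C T + (size rs)^2
   E. *)
have pair r r' : r \in rs -> r' \in rs ->
    \sum_(0 <= s < L) \sum_(0 <= i < L + X)
      g r (c - L + s + i)%N * g r' (c - L + s + i)%N <=
    (r' == r)%:R * (C * V r) + E.
  move=> rrs r'rs.
  have /andP[dr rD] := rsd _ rrs; have /andP[dr' r'D] := rsd _ r'rs.
  have r0 : (0 < r)%N by apply: leq_trans d0 dr.
  have r'0 : (0 < r')%N by apply: leq_trans d0 dr'.
  have E0 : 0 <= E by apply: mulr_ge0; [apply: mulr_ge0 => //|]; exact: sqr_ge0.
  have [->|rr'] := eqVneq r' r.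
    rewrite mul1r; apply: le_trans (_ : C * V r <= _); last by rewrite lerDl.
    rewrite /C -mulrA mulr_natl.
    have -> : ((L + X) %/ d).+1%:R * V r *+ L =
      \sum_(0 <= s < L) (((L + X) %/ d).+1%:R * V r) by rewrite sumr_const_nat subn0.
    apply: ler_sum => s _; under eq_bigr => i _ do rewrite -expr2.
    have V0 : 0 <= V r by apply: sumr_ge0 => n _; exact: sqr_ge0.
    apply: le_trans (_ : ((L + X) %/ r).+1%:R * V r <= _).
      apply: (sum_periodic_le (f := fun n => g r n ^+ 2)) => // [n|n]; last exact: sqr_ge0.
      by rewrite per.
    by rewrite ler_wpM2r // ler_nat ltnS leq_div2l.
  rewrite mul0r add0r.
  have cop : coprime r r' by apply: co => //; rewrite eq_sym.
  pose h n := g r n * g r' n.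
  have perh : periodic (r' * r)%N h.
    move=> n; rewrite /h periodic_addM; last exact: per.
    by rewrite mulnC periodic_addM; last exact: per.
  have rr0 : (0 < r' * r)%N by rewrite muln_gt0 r0 r'0.
  have h0 : \sum_(0 <= n < r' * r) h n = 0.
    by rewrite sum_periodic_crt ?mean0 ?mul0r //; exact: per.
  apply: le_trans (averaged_window_le _ _ _ rr0 perh h0) _.
  have -> : \sum_(0 <= n < r' * r) `|h n| =
      (\sum_(0 <= n < r) `|g r n|) * (\sum_(0 <= n < r') `|g r' n|).
    rewrite -sum_periodic_crt //; last 2 first.
    - by move=> n; rewrite per.
    - by move=> n; rewrite per.
    by apply: eq_bigr => n _; rewrite normrM.
  rewrite /E natrM.
  have n0 q : 0 <= \sum_(0 <= n < q) `|g q n| by apply: sumr_ge0.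
  rewrite -!mulrA ler_wpM2l //.
  rewrite [leLHS](_ : _ = (r'%:R * (\sum_(0 <= n < r') `|g r' n|)) *
    (r%:R * (\sum_(0 <= n < r) `|g r n|))); last by ring.
  rewrite [leRHS](_ : _ = (D%:R * M) * (D%:R * M)); last by ring.
  apply: ler_pM; rewrite ?mulr_ge0 //.
  - by apply: ler_pM => //; rewrite ?ler_nat // gM.
  - by apply: ler_pM => //; rewrite ?ler_nat // gM.
have cs : T ^+ 2 <= (size A)%:R * \sum_(p <- A) G p ^+ 2 by rewrite -ET; exact: sqr_sum_le.
apply: le_trans (ler_wpM2l _ cs) _; first exact: ler0n.
rewrite mulrCA ler_wpM2l //.
apply: le_trans (_ : \sum_(0 <= s < L) \sum_(0 <= i < L + X) G (c - L + s + i)%N ^+ 2 <= _).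
  rewrite mulr_natl -[X in _ *+ X]subn0 -sumr_const_nat.
  by rewrite big_nat_cond [leRHS]big_nat_cond; apply: ler_sum => s /andP[/andP[_ sL] _]; exact: bound.
have -> : \sum_(0 <= s < L) \sum_(0 <= i < L + X) G (c - L + s + i)%N ^+ 2 =
  \sum_(r <- rs) \sum_(r' <- rs) \sum_(0 <= s < L) \sum_(0 <= i < L + X)
      g r (c - L + s + i)%N * g r' (c - L + s + i)%N.
  under [RHS]eq_bigr => r _.
    rewrite exchange_big; under eq_bigr => s _ do rewrite exchange_big /=.
    over.
  rewrite [RHS]exchange_big; apply: eq_bigr => s _.
  rewrite [RHS]exchange_big; apply: eq_bigr => i _.
  rewrite expr2 /G mulr_suml; apply: eq_bigr => r _.
  by rewrite mulr_sumr.
rewrite -/C.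
apply: le_trans (_ : \sum_(r <- rs) (C * V r + (size rs)%:R * E) <= _).
  rewrite big_seq [leRHS]big_seq; apply: ler_sum => r rrs.
  apply: le_trans (_ : \sum_(r' <- rs) ((r' == r)%:R * (C * V r) + E) <= _).
    by rewrite big_seq [leRHS]big_seq; apply: ler_sum => r' r'rs; exact: pair.
  rewrite big_split /= -mulr_suml (bigD1_seq r) //= eqxx big1 ?addr0 ?mul1r; last first.
    by move=> r' /negbTE ->.
  by rewrite big_const_seq count_predT iter_addr_0 mulr_natl.
rewrite big_split /= -mulr_sumr big_const_seq count_predT iter_addr_0.
by rewrite -[X in _ + X]mulr_natl mulrA -expr2.
Qed.

End Ordered.

(** * Deviation from equidistribution in residue classes *)

Section Deviation.
Variable R : realFieldType.

(** These are g_r and V_r of the outline: [dev A r] is g_r and [residue_variance A r] is V_r. *)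
Definition dev (A : seq nat) (r n : nat) : R :=
  (count (fun p => p == n %[mod r])%N A)%:R - (size A)%:R / r%:R.

Definition residue_variance A r : R := \sum_(0 <= n < r) dev A r n ^+ 2.

Lemma periodic_dev A r : periodic r (dev A r).
Proof.
by move=> n; rewrite /dev; congr (_%:R - _); apply: eq_count => p; rewrite modnDr.
Qed.

Lemma sum_over_residues A r (f : nat -> R) : (0 < r)%N -> periodic r f ->
  \sum_(0 <= n < r) (count (fun p => p == n %[mod r])%N A)%:R * f n = \sum_(p <- A) f p.
Proof.
move=> r0 per; elim: A => [|p A IH].
  by rewrite big_nil big1 // => n _; rewrite /= mul0r.
rewrite big_cons -IH /=.
under eq_bigr => n _ do rewrite natrD mulrDl.
rewrite big_split /=; congr (_ + _).
rewrite (bigD1_seq (p %% r)%N) ?iota_uniq ?mem_index_iota ?ltn_pmod //=.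
rewrite modn_mod eqxx mul1r periodic_mod //.
rewrite big_nat_cond big1 ?addr0 // => n /andP[/andP[_ nr] np].
by rewrite (modn_small nr) eq_sym (negbTE np) mul0r.
Qed.

Lemma sum_count_residues A r : (0 < r)%N ->
  \sum_(0 <= n < r) (count (fun p => p == n %[mod r])%N A)%:R = (size A)%:R :> R.
Proof.
move=> r0; have := @sum_over_residues A r (fun=> 1) r0 (fun=> erefl).
rewrite big_const_seq count_predT iter_addr_0 => <-.
by apply: eq_bigr => n _; rewrite mulr1.
Qed.

Lemma sum_dev A r : (0 < r)%N -> \sum_(0 <= n < r) dev A r n = 0.
Proof.
move=> r0; rewrite sumrB sum_count_residues // sumr_const_nat subn0.
by rewrite -[_ / _ *+ _]mulr_natr divfK ?subrr // pnatr_eq0 -lt0n.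
Qed.

Lemma sum_norm_dev A r : (0 < r)%N ->
  \sum_(0 <= n < r) `|dev A r n| <= 2 * (size A)%:R.
Proof.
move=> r0; apply: le_trans (ler_sum _ (fun n _ => ler_normB _ _)) _.
rewrite big_split /=.
under eq_bigr => n _ do rewrite normr_nat.
rewrite sum_count_residues // sumr_const_nat subn0 ger0_norm ?divr_ge0 //.
by rewrite -[_ / _ *+ _]mulr_natr divfK ?pnatr_eq0 -?lt0n // mulr_natl mulr2n.
Qed.

(** Grouping A by residues weights each deviation by its class count; as the deviations sum to zero,
    the count may be replaced by the deviation itself. *)
Lemma sum_dev_self A r : (0 < r)%N -> \sum_(p <- A) dev A r p = residue_variance A r.
Proof.
move=> r0; rewrite -(sum_over_residues A r0); last exact: periodic_dev.
transitivity (\sum_(0 <= n < r) (dev A r n ^+ 2 + (size A)%:R / r%:R * dev A r n)).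
  by apply: eq_bigr => n _; rewrite expr2 -mulrDl /dev subrK.
by rewrite big_split /= -mulr_sumr sum_dev // mulr0 addr0.
Qed.

Lemma residue_variance_ge0 A r : 0 <= residue_variance A r.
Proof. by apply: sumr_ge0 => n _; exact: sqr_ge0. Qed.

Lemma variance_sieve (A rs : seq nat) (L X d D : nat) (T : R) :
  uniq A -> {in A, forall p, p < X}%N ->
  uniq rs -> {in rs, forall r, prime r} -> (0 < d)%N -> {in rs, forall r, d <= r <= D}%N ->
  T = \sum_(r <- rs) residue_variance A r ->
  L%:R * T ^+ 2 <= (size A)%:R * (L%:R * ((L + X) %/ d).+1%:R * T +
    (size rs)%:R ^+ 2 * (8 * D%:R ^+ 2 * (size A)%:R ^+ 2)).
Proof.
move=> uA AX urs prs d0 rsd ->.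
have p0 r : r \in rs -> (0 < r)%N by move=> /prs /prime_gt0.
(* The sieve is applied with M = 2 [size A], the bound of [sum_norm_dev]. *)
have -> : 8 * D%:R ^+ 2 * (size A)%:R ^+ 2 = 2 * D%:R ^+ 2 * (2 * (size A)%:R) ^+ 2 :> R by ring.
apply: (large_sieve (g := dev A)) => //.
- by move=> r r' /prs pr /prs pr' rr'; rewrite prime_coprime // dvdn_prime2.
- by move=> r _; exact: periodic_dev.
- by move=> r /p0 r0; exact: sum_dev.
- by move=> r /p0 r0; exact: sum_norm_dev.
rewrite exchange_big /= big_seq [RHS]big_seq; apply: eq_bigr => r /p0 r0.
exact: sum_dev_self.
Qed.

(* Since r.-1 = -1 modulo r, this is the deviation of A in the residue class of -n. *)
Lemma oppcount_dev A r n : (0 < r)%N ->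
  (oppcount A r n)%:R - (size A)%:R / r%:R = dev A r (n * r.-1)%N.
Proof.
move=> r0; rewrite /dev; congr (_%:R - _); apply: eq_count => p.
rewrite -(eqn_modDl n) -mulnS prednK // modnMl /dvdn //.
Qed.

(** The sum over A is enlarged to all n < X, which fits into X / r + 1 periods; over one period n ->
    -n only permutes the classes. *)
Lemma sum_sqr_oppcount_le A r X : (0 < r)%N -> uniq A -> {in A, forall p, p < X}%N ->
  \sum_(p <- A) ((oppcount A r p)%:R - (size A)%:R / r%:R) ^+ 2 <=
  (X %/ r).+1%:R * residue_variance A r.
Proof.
move=> r0 uA AX; pose f n := dev A r (n * r.-1)%N ^+ 2.
have perf : periodic r f.
  by move=> n; rewrite /f mulnDl mulnC [(r * _)%N]mulnC periodic_addM 1?mulnC //; exact: periodic_dev.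
under eq_bigr => p _ do rewrite oppcount_dev //.
apply: le_trans (_ : \sum_(n <- index_iota 0 X) f n <= _).
  apply: sum_subset_le => //; last exact: iota_uniq.
    by move=> p /AX; rewrite mem_index_iota.
  by move=> n; exact: sqr_ge0.
apply: le_trans (sum_periodic_le 0 X r0 perf _) _.
  by move=> n; exact: sqr_ge0.
rewrite /f /residue_variance.
rewrite -(sum_periodic_affine (f := fun n => dev A r n ^+ 2) (Q := r) (r := r.-1) 0).
- by rewrite [X in _ <= _ * X](eq_bigr f) // => j _; rewrite addn0.
- by move=> n; rewrite periodic_dev.
- exact: coprimePn.
Qed.

(* Either both f_i >= u_i / 2, or the left-hand side is nonpositive. *)
Lemma mul_oppcount_lower (u1 u2 f1 f2 : R) : 0 < u1 -> 0 < u2 -> 0 <= f1 -> 0 <= f2 ->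
  u1 * u2 / 4 * (1 - 4 * ((f1 - u1) / u1) ^+ 2 - 4 * ((f2 - u2) / u2) ^+ 2) <= f1 * f2.
Proof.
move=> u1p u2p f1p f2p.
have E (u f : R) : 0 < u -> (f - u) / u = f / u - 1.
  by move=> u0; field; exact: lt0r_neq0.
rewrite !E //.
have [g1 Ef1] : exists g, f1 = g * u1 by exists (f1 / u1); rewrite divfK ?gt_eqF.
have [g2 Ef2] : exists g, f2 = g * u2 by exists (f2 / u2); rewrite divfK ?gt_eqF.
rewrite Ef1 Ef2 !mulfK ?gt_eqF //.
have g1p : 0 <= g1 by rewrite -(pmulr_lge0 _ u1p) -Ef1.
have g2p : 0 <= g2 by rewrite -(pmulr_lge0 _ u2p) -Ef2.
have -> : g1 * u1 * (g2 * u2) = u1 * u2 / 4 * (4 * (g1 * g2)) by field.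
rewrite ler_pM2l ?divr_gt0 ?mulr_gt0 //.
have [h1|h1] := lerP g1 (1 / 2).
  have : 0 <= g1 * g2 by rewrite mulr_ge0.
  by have := sqr_ge0 (g2 - 1); nra.
have [h2|h2] := lerP g2 (1 / 2).
  have : 0 <= g1 * g2 by rewrite mulr_ge0.
  by have := sqr_ge0 (g1 - 1); nra.
have := sqr_ge0 (g1 - 1); have := sqr_ge0 (g2 - 1).
nra.
Qed.

(** With u_i = N / r_i, [mul_oppcount_lower] is summed over A. Each of the two error terms costs at
    most N / 4, so that u1 u2 / 4 times N / 2 remains. *)
Lemma pair_count A r1 r2 : (0 < r1)%N -> (0 < r2)%N -> (0 < size A)%N ->
  (forall r, r \in [:: r1; r2] ->
   \sum_(p <- A) ((oppcount A r p)%:R - (size A)%:R / r%:R) ^+ 2 <=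
    (size A)%:R ^+ 3 / (16 * r%:R ^+ 2) :> R) ->
  (size A)%:R ^+ 3 / (8 * r1%:R * r2%:R) <= (size (divisor_triples A r1 r2))%:R :> R.
Proof.
move=> r10 r20 N0 H; rewrite size_divisor_triples natr_sum.
set N : R := (size A)%:R; have Np : 0 < N by rewrite ltr0n.
have r1p : 0 < r1%:R :> R by rewrite ltr0n.
have r2p : 0 < r2%:R :> R by rewrite ltr0n.
pose u1 := N / r1%:R; pose u2 := N / r2%:R.
have u1p : 0 < u1 by rewrite divr_gt0.
have u2p : 0 < u2 by rewrite divr_gt0.
pose e r p : R := (oppcount A r p)%:R - N / r%:R.
apply: le_trans (_ : \sum_(p <- A) (u1 * u2 / 4 * (1 - 4 * (e r1 p / u1) ^+ 2 - 4 * (e r2 p / u2) ^+ 2)) <= _); last first.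
  by apply: ler_sum => p _; rewrite natrM; exact: mul_oppcount_lower.
have S r u : 0 < u -> \sum_(p <- A) 4 * (e r p / u) ^+ 2 = 4 / u ^+ 2 * \sum_(p <- A) e r p ^+ 2.
  move=> up; rewrite mulr_sumr; apply: eq_bigr => p _; field; exact: lt0r_neq0.
rewrite -mulr_sumr !sumrB !S //.
rewrite big_const_seq count_predT iter_addr_0 -/N.
have B r : r \in [:: r1; r2] -> 0 < r%:R :> R ->
    4 / (N / r%:R) ^+ 2 * \sum_(p <- A) e r p ^+ 2 <= N / 4.
  move=> rr rp; apply: le_trans (_ : 4 / (N / r%:R) ^+ 2 * (N ^+ 3 / (16 * r%:R ^+ 2)) <= _).
    by rewrite ler_wpM2l ?H // divr_ge0 // exprn_ge0 // divr_ge0 // ltW.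
  rewrite le_eqVlt; apply/orP; left; apply/eqP; field.
  by rewrite !lt0r_neq0.
have B1 := B r1 ltac:(by rewrite mem_head) r1p.
have B2 := B r2 ltac:(by rewrite !inE eqxx orbT) r2p.
have -> : N ^+ 3 / (8 * r1%:R * r2%:R) = u1 * u2 / 4 * (N - N / 4 - N / 4).
  by rewrite /u1 /u2; field; rewrite !lt0r_neq0.
rewrite ler_pM2l; last by rewrite divr_gt0 // mulr_gt0.
rewrite -/u1 -/u2 in B1 B2; lra.
Qed.

(** Markov's inequality: otherwise all but at most one of the V r would exceed v. *)
Lemma exists_two_small (rs : seq nat) (V : nat -> R) v : uniq rs -> 0 < v ->
  (forall r, 0 <= V r) -> \sum_(r <- rs) V r < ((size rs)%:R - 1) * v ->
  exists r1 r2, [/\ r1 \in rs, r2 \in rs, r1 != r2, V r1 <= v & V r2 <= v].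
Proof.
move=> urs v0 V0 lt; pose good := [seq r <- rs | V r <= v].
have : (1 < size good)%N.
  rewrite -(ltr_nat R) -(ltr_pM2r v0) mul1r.
  have : (size rs)%:R = (size good)%:R + (count (fun r => ~~ (V r <= v)) rs)%:R :> R.
    by rewrite size_filter -natrD count_predC.
  have : (count (fun r => ~~ (V r <= v)) rs)%:R * v <= \sum_(r <- rs) V r.
    rewrite -sum1_count natr_sum mulr_suml [leLHS]big_mkcond.
    by apply: ler_sum => r _; case: ifP; rewrite -?ltNge ?mul1r //; move/ltW.
  by move=> h1 h2; rewrite h2 in lt; lra.
have : uniq good by rewrite filter_uniq.
have : {subset good <= [seq r <- rs | V r <= v]} by [].
case: good => [|r1 [|r2 good]] //= sub /andP[+ _] _.
rewrite inE negb_or => /andP[r12 _].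
have := sub r1 (mem_head _ _); have := sub r2; rewrite !inE eqxx orbT => /(_ isT).
by rewrite !mem_filter => /andP[? ?] /andP[? ?]; exists r1, r2.
Qed.

End Deviation.

(** * Choice of the parameters *)

Section Arith.
Variable R : realFieldType.

(** Here s = sqrt x, l = log x, N and K count the primes and the moduli. If the bound failed, T
    would be at least t = K v / 2, and each term on the right of the sieve inequality would be at
    most L T^2 / 4, a contradiction. *)
Lemma sieve_threshold (s l N K L X M D T : R) :
  0 < s -> 10 ^+ 7 <= l -> l ^+ 13 <= s -> s ^+ 2 <= 12 * l * N -> s <= 4 * K ->
  s ^+ 2 * l ^+ 10 <= L -> L <= 2 * s ^+ 2 * l ^+ 10 -> X <= 5 * s ^+ 2 ->
  M <= (L + X) / (s * l) + 1 -> 0 <= D -> D <= 2 * (s * l) ->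
  L * T ^+ 2 <= N * (L * M * T + K ^+ 2 * (8 * D ^+ 2 * N ^+ 2)) ->
  T < (K - 1) * (N ^+ 3 / (224 * s ^+ 2 * (s * l))).
Proof.
move=> s0 l7 ls HN HK HL1 HL2 HX HM D0 HD HT.
have l1 : 1 <= l by apply: le_trans l7; rewrite exprn_ege1 // ler1n.
have l0 : 0 < l by lra.
have ln n : 1 <= l ^+ n by exact: exprn_ege1.
have l_s : l <= s.
  by apply: le_trans ls; rewrite -[leLHS]expr1 ler_weXn2l.
have N0 : 0 < N.
  have l12 : 0 < 12 * l by rewrite mulr_gt0.
  by rewrite -(pmulr_rgt0 _ l12); apply: lt_le_trans HN; rewrite exprn_gt0.
set y := s * l; have y0 : 0 < y by rewrite mulr_gt0.
have s20 : 0 < s ^+ 2 by rewrite exprn_gt0.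
have HNn n : (s ^+ 2) ^+ n <= (12 * l * N) ^+ n.
  have l12N : 0 <= 12 * l * N by rewrite ltW // !mulr_gt0.
  by apply: lerXn2r => //; rewrite nnegrE // ltW.
have L0 : 0 < L by apply: lt_le_trans HL1; rewrite mulr_gt0 // exprn_gt0.
have K2 : K / 2 <= K - 1 by have : (10:R) ^+ 7 <= s by [exact: le_trans l_s]; lra.
have K0 : 0 < K by lra.
pose v := N ^+ 3 / (224 * s ^+ 2 * y).
have v0 : 0 < v by rewrite divr_gt0 ?exprn_gt0 // mulr_gt0 // mulr_gt0.
rewrite -/v ltNge; apply/negP => TK.
pose t := K / 2 * v.
have t0 : 0 < t by rewrite mulr_gt0 // divr_gt0.
have tT : t <= T by apply: le_trans TK; rewrite ler_wpM2r // ltW.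
have T0 : 0 < T by apply: lt_le_trans tT.
have M2 : M <= 2 * L / y.
  apply: le_trans HM _; have -> : (L + X) / y + 1 = (L + X + y) / y by field; exact: lt0r_neq0.
  rewrite ler_wpM2r ?invr_ge0 ?(ltW y0) //.
  suff : X + y <= L by lra.
  have y_s2 : y <= s ^+ 2 by rewrite expr2 ler_wpM2l // ltW.
  have : 6 * s ^+ 2 <= s ^+ 2 * l ^+ 10.
    rewrite mulrC ler_wpM2l ?(ltW s20) //; apply: le_trans (_ : l <= _).
      by apply: ltW; apply: lt_le_trans l7; rewrite !exprS; lra.
    by rewrite -[leLHS]expr1 ler_weXn2l.
  lra.
(* With s^2 <= 12 l N and s <= 4 K this reduces to 576 * 7168 * l^12 <= s, which follows from 10^7
   <= l and l^13 <= s. *)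
have A : N * (2 * L / y) <= t / 4.
  rewrite /t /v.
  have -> : N * (2 * L / y) = (2 * L * (1792 * s ^+ 2)) * (N / (1792 * s ^+ 2 * y)).
    by field; rewrite !lt0r_neq0.
  have -> : K / 2 * (N ^+ 3 / (224 * s ^+ 2 * y)) / 4 = (K * N ^+ 2) * (N / (1792 * s ^+ 2 * y)).
    by field; rewrite !lt0r_neq0.
  apply: ler_wpM2r; first by rewrite divr_ge0 ?ltW // mulr_gt0 // mulr_gt0.
  apply: le_trans (_ : 7168 * s ^+ 4 * l ^+ 10 <= _).
    have : L * (s ^+ 2) <= 2 * s ^+ 2 * l ^+ 10 * s ^+ 2 by apply: ler_wpM2r => //; exact: ltW.
    have -> : 2 * s ^+ 2 * l ^+ 10 * s ^+ 2 = 2 * (s ^+ 4 * l ^+ 10) by ring.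
    have -> : 2 * L * (1792 * s ^+ 2) = 3584 * (L * s ^+ 2) by ring.
    have -> : 7168 * s ^+ 4 * l ^+ 10 = 7168 * (s ^+ 4 * l ^+ 10) by ring.
    by move: (L * _) (s ^+ 4 * _) => a b h; lra.
  have l2p : 0 < 576 * l ^+ 2 by rewrite mulr_gt0 // exprn_gt0.
  rewrite -(ler_pM2l l2p).
  apply: le_trans (_ : s * s ^+ 4 <= _); last first.
    have -> : 576 * l ^+ 2 * (K * N ^+ 2) = 4 * K * (12 * l * N) ^+ 2 by ring.
    have -> : s ^+ 4 = (s ^+ 2) ^+ 2 by ring.
    apply: ler_pM => //; [exact: ltW|exact: sqr_ge0].
  have -> : 576 * l ^+ 2 * (7168 * s ^+ 4 * l ^+ 10) = (576 * 7168 * l ^+ 12) * s ^+ 4 by ring.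
  apply: ler_wpM2r; first by rewrite exprn_ge0 // ltW.
  apply: le_trans ls; rewrite (exprS l 12); apply: ler_wpM2r; first by rewrite exprn_ge0 // ltW.
  by apply: le_trans l7; lra.
(* After cancellation this reads 1728 * 512 * 224^2 <= l^3; the factor l^10 in L supplies the power
   l^3. *)
have B : N * (K ^+ 2 * (32 * y ^+ 2 * N ^+ 2)) <= L * t ^+ 2 / 4.
  rewrite /t /v.
  have -> : N * (K ^+ 2 * (32 * y ^+ 2 * N ^+ 2)) =
     (512 * 224 ^+ 2 * (s ^+ 4 * y ^+ 4)) * (K ^+ 2 * N ^+ 3 / (16 * 224 ^+ 2 * s ^+ 4 * y ^+ 2)).
    by field; rewrite !lt0r_neq0.
  have -> : L * (K / 2 * (N ^+ 3 / (224 * s ^+ 2 * y))) ^+ 2 / 4 =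
     (L * N ^+ 3) * (K ^+ 2 * N ^+ 3 / (16 * 224 ^+ 2 * s ^+ 4 * y ^+ 2)).
    by field; rewrite !lt0r_neq0.
  apply: ler_wpM2r; first by rewrite divr_ge0 ?ltW // !mulr_gt0 ?exprn_gt0.
  have lp : 0 < 1728 * l ^+ 3 by rewrite mulr_gt0 // exprn_gt0.
  rewrite -(ler_pM2l lp).
  apply: le_trans (_ : (s ^+ 2 * l ^+ 10) * (s ^+ 2) ^+ 3 <= _); last first.
    have -> : 1728 * l ^+ 3 * (L * N ^+ 3) = L * (12 * l * N) ^+ 3 by ring.
    by apply: ler_pM => //; rewrite ltW // ?mulr_gt0 // exprn_gt0.
  rewrite /y.
  have -> : 1728 * l ^+ 3 * (512 * 224 ^+ 2 * (s ^+ 4 * (s * l) ^+ 4)) =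
     (1728 * 512 * 224 ^+ 2) * (s ^+ 8 * l ^+ 7) by ring.
  have -> : s ^+ 2 * l ^+ 10 * (s ^+ 2) ^+ 3 = l ^+ 3 * (s ^+ 8 * l ^+ 7) by ring.
  apply: ler_wpM2r; first by rewrite mulr_ge0 ?exprn_ge0 ?ltW.
  apply: le_trans (_ : (10 ^+ 7) ^+ 3 <= _); last by apply: lerXn2r => //; rewrite nnegrE ?exprn_ge0 // ltW.
  lra.
have D2 : D ^+ 2 <= 4 * y ^+ 2.
  have -> : 4 * y ^+ 2 = (2 * y) ^+ 2 by ring.
  by apply: lerXn2r => //; rewrite nnegrE // mulr_ge0 // ltW.
have H1 : N * (L * M * T) <= L * T ^+ 2 / 4.
  have -> : N * (L * M * T) = (N * M) * (L * T) by ring.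
  have -> : L * T ^+ 2 / 4 = (T / 4) * (L * T) by ring.
  apply: ler_wpM2r; first by rewrite mulr_ge0 ?ltW.
  apply: le_trans (_ : N * (2 * L / y) <= _); first by rewrite ler_wpM2l // ltW.
  by apply: le_trans A _; lra.
have H2 : N * (K ^+ 2 * (8 * D ^+ 2 * N ^+ 2)) <= L * T ^+ 2 / 4.
  apply: le_trans (_ : N * (K ^+ 2 * (32 * y ^+ 2 * N ^+ 2)) <= _).
    rewrite (ler_wpM2l (ltW N0)) // ler_wpM2l ?sqr_ge0 // ler_wpM2r ?sqr_ge0 //.
    lra.
  apply: le_trans B _; rewrite ler_wpM2r ?invr_ge0 // ler_wpM2l ?(ltW L0) //.
  by apply: lerXn2r => //; rewrite nnegrE ltW.
have LT : 0 < L * T ^+ 2 by rewrite mulr_gt0 // exprn_gt0.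
rewrite mulrDr in HT; lra.
Qed.

(** Turns the bound on V_r into the hypothesis of [pair_count], with q = floor(X / r). Since q r^2
    <= 10 s^2 (s l) and r^2 <= 4 s^2 (s l), the constant is 224 = 16 (10 + 4). *)
Lemma variance_small_enough (s l N X r V q : R) : 0 < s -> 5 <= l -> l <= s -> 0 < N ->
  X <= 5 * s ^+ 2 -> 0 < r -> r <= 2 * (s * l) -> 0 <= q -> q * r <= X -> 0 <= V ->
  V <= N ^+ 3 / (224 * s ^+ 2 * (s * l)) ->
  (q + 1) * V <= N ^+ 3 / (16 * r ^+ 2).
Proof.
move=> s0 l5 ls N0 HX r0 ry q0 qr V0 HV.
have y0 : 0 < s * l by rewrite mulr_gt0 //; lra.
have l0 : 0 < l by lra.
have r20 : 0 < 16 * r ^+ 2 by rewrite mulr_gt0 // exprn_gt0.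
rewrite ler_pdivlMr //.
apply: le_trans (_ : ((q + 1) * (16 * r ^+ 2)) * (N ^+ 3 / (224 * s ^+ 2 * (s * l))) <= _).
  rewrite mulrAC ler_wpM2l // mulr_ge0 ?(ltW r20) //; lra.
have D0 : 0 < 224 * s ^+ 2 * (s * l) by rewrite mulr_gt0 // mulr_gt0 // exprn_gt0.
rewrite mulrA ler_pdivrMr // mulrC ler_wpM2l ?exprn_ge0 ?(ltW N0) //.
have h1 : (q * r) * r <= (5 * s ^+ 2) * (2 * (s * l)).
  by apply: ler_pM; rewrite ?mulr_ge0 ?(ltW r0) ?(le_trans qr HX).
have h2 : r * r <= (2 * (s * l)) * (2 * (s * l)) by apply: ler_pM; rewrite ?(ltW r0).
have h3 : (s * l) * (s * l) <= s ^+ 2 * (s * l).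
  by rewrite ler_wpM2r ?(ltW y0) // expr2 ler_wpM2l // ltW.
have -> : (q + 1) * (16 * r ^+ 2) = 16 * ((q * r) * r) + 16 * (r * r) by ring.
move: h1 h2 h3; set a := s ^+ 2 * (s * l); set b := (s * l) * (s * l).
have -> : 5 * s ^+ 2 * (2 * (s * l)) = 10 * a by rewrite /a; ring.
have -> : 2 * (s * l) * (2 * (s * l)) = 4 * b by rewrite /b; ring.
have -> : 224 * s ^+ 2 * (s * l) = 224 * a by rewrite /a; ring.
move=> *; lra.
Qed.

(** The triples number at least N^3 / (32 y^2) with y = s l. Half of this exceeds the pigeonhole
    loss 27 m Q, and the other half covers the bad triples. *)
Lemma enough_triples (s l N m Q r1 r2 q1 q2 X T : R) :
  0 < s -> 10 ^+ 7 <= l -> l ^+ 13 <= s -> s ^+ 2 <= 12 * l * N -> X <= 5 * s ^+ 2 ->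
  s * l < r1 -> r1 <= 2 * (s * l) -> s * l < r2 -> r2 <= 2 * (s * l) ->
  q1 * r1 <= X -> q2 * r2 <= X -> 0 <= q1 -> 0 <= q2 ->
  0 <= m -> m <= 1 / 10 ^+ 8 * (s ^+ 2 / l ^+ 4) -> 0 <= Q -> Q <= 25 * (s ^+ 2 / l) ->
  N ^+ 3 / (8 * r1 * r2) <= T ->
  27 * m * Q + (N * (q1 + 1) + N * (q2 + 1)) < T.
Proof.
move=> s0 l7 ls HN HX r1y r1y2 r2y r2y2 qr1 qr2 q10 q20 m0 Hm Q0 HQ HT.
have l1 : 1 <= l by apply: le_trans l7; rewrite exprn_ege1 // ler1n.
have l0 : 0 < l by lra.
have l_s : l <= s.
  by apply: le_trans ls; rewrite -[leLHS]expr1 ler_weXn2l.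
have s20 : 0 < s ^+ 2 by rewrite exprn_gt0.
have N0 : 0 < N.
  have l12 : 0 < 12 * l by rewrite mulr_gt0.
  by rewrite -(pmulr_rgt0 _ l12); apply: lt_le_trans HN; rewrite exprn_gt0.
set y := s * l in r1y r1y2 r2y r2y2 *; have y0 : 0 < y by rewrite mulr_gt0.
have HNn n : (s ^+ 2) ^+ n <= (12 * l * N) ^+ n.
  have l12N : 0 <= 12 * l * N by rewrite ltW // !mulr_gt0.
  by apply: lerXn2r => //; rewrite nnegrE // ltW.
have qs q r : 0 <= q -> y < r -> q * r <= X -> q + 1 <= 6 * s.
  move=> q0 yr qr; have : q <= 5 * s.
    rewrite -(ler_pM2r y0); apply: le_trans (_ : q * r <= _); first by rewrite ler_wpM2l // ltW.
    apply: le_trans qr _; apply: le_trans HX _; rewrite /y.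
    have -> : 5 * s * (s * l) = 5 * s ^+ 2 * l by ring.
    by rewrite ler_peMr // mulr_ge0 // ltW.
  have : 1 <= s by exact: le_trans l_s.
  lra.
have b1 := qs _ _ q10 r1y qr1; have b2 := qs _ _ q20 r2y qr2.
have Tl : N ^+ 3 / (32 * y ^+ 2) <= T.
  apply: le_trans HT; rewrite ler_wpM2l ?exprn_ge0 ?(ltW N0) // lef_pV2 ?posrE; last 2 first.
  - by rewrite mulr_gt0 // exprn_gt0.
  - by rewrite !mulr_gt0 //; apply: lt_trans y0 _.
  have h : r1 * r2 <= (2 * y) * (2 * y) by apply: ler_pM => //; apply: ltW; apply: lt_trans y0 _.
  have -> : 32 * y ^+ 2 = 8 * ((2 * y) * (2 * y)) by ring.
  by rewrite -mulrA ler_wpM2l.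
have bad : N * (q1 + 1) + N * (q2 + 1) <= N ^+ 3 / (64 * y ^+ 2).
  apply: le_trans (_ : N * (12 * s) <= _).
    by rewrite -mulrDr ler_wpM2l ?(ltW N0) //; lra.
  have -> : N ^+ 3 / (64 * y ^+ 2) = N * (N ^+ 2 / (64 * y ^+ 2)) by ring.
  rewrite ler_wpM2l ?(ltW N0) // ler_pdivlMr ?mulr_gt0 ?exprn_gt0 //.
  have lp : 0 < 144 * l ^+ 2 by rewrite mulr_gt0 // exprn_gt0.
  rewrite -(ler_pM2l lp).
  have -> : 144 * l ^+ 2 * N ^+ 2 = (12 * l * N) ^+ 2 by ring.
  apply: le_trans (_ : (s ^+ 2) ^+ 2 <= _); last first.
    exact: HNn.
  have -> : 144 * l ^+ 2 * (12 * s * (64 * y ^+ 2)) = (144 * 768 * l ^+ 4) * s ^+ 3 by rewrite /y; ring.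
  have -> : (s ^+ 2) ^+ 2 = s * s ^+ 3 by ring.
  apply: ler_wpM2r; first by rewrite exprn_ge0 // ltW.
  apply: le_trans ls; apply: le_trans (_ : l * l ^+ 4 <= _).
    apply: ler_wpM2r; first by rewrite exprn_ge0 // ltW.
    by apply: le_trans l7; lra.
  by rewrite -exprS ler_weXn2l.
(* The constant 1 / 10^8 is chosen so that 27 * 25 / 10^8 < 1 / (64 * 1728), where 1728 = 12^3 comes
   from the lower bound for N. *)
have main : 27 * m * Q < N ^+ 3 / (64 * y ^+ 2).
  apply: le_lt_trans (_ : 27 * (1 / 10 ^+ 8 * (s ^+ 2 / l ^+ 4)) * (25 * (s ^+ 2 / l)) < _).
    by apply: ler_pM => //; rewrite ?mulr_ge0 // ler_wpM2l.
  have -> : 27 * (1 / 10 ^+ 8 * (s ^+ 2 / l ^+ 4)) * (25 * (s ^+ 2 / l)) =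
    (675 / 10 ^+ 8) * (s ^+ 4 / l ^+ 5) by field; rewrite !lt0r_neq0.
  apply: lt_le_trans (_ : (1 / (64 * 1728)) * (s ^+ 4 / l ^+ 5) <= _).
    rewrite ltr_pM2r ?divr_gt0 ?exprn_gt0 //; lra.
  rewrite ler_pdivlMr ?mulr_gt0 ?exprn_gt0 //.
  have -> : 1 / (64 * 1728) * (s ^+ 4 / l ^+ 5) * (64 * y ^+ 2) = (s ^+ 2) ^+ 3 / (1728 * l ^+ 3).
    by rewrite /y; field; rewrite !lt0r_neq0.
  rewrite ler_pdivrMr ?mulr_gt0 ?exprn_gt0 //.
  have -> : N ^+ 3 * (1728 * l ^+ 3) = (12 * l * N) ^+ 3 by ring.
  exact: HNn.
have E : N ^+ 3 / (32 * y ^+ 2) = N ^+ 3 / (64 * y ^+ 2) + N ^+ 3 / (64 * y ^+ 2).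
  by field; rewrite !lt0r_neq0.
lra.
Qed.

End Arith.

From mathcomp Require Import all_classical all_reals all_analysis.
Import Order.TTheory GRing.Theory Num.Theory.

(** * Chebyshev's estimates with real parameters *)

Section Analysis.
Variable R : realType.
Implicit Types x y z : R.

Definition primes_between y : seq nat :=
  [seq p <- iota 0 (Num.truncn (2 * y)).+1 | prime p && (y < p%:R)].

Lemma mem_primes_between y p : 0 <= y ->
  (p \in primes_between y) = prime p && (y < p%:R <= 2 * y).
Proof.
move=> y0; rewrite mem_filter mem_iota /= add0n ltnS -andbA; congr [&& _, _ & _].
have y20 : 0 <= 2 * y by rewrite mulr_ge0.
have /andP[h1 h2] := truncn_itv y20.
apply/idP/idP => h.
  by apply: le_trans h1; rewrite ler_nat.
by rewrite -ltnS -(ltr_nat R); apply: le_lt_trans h2.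
Qed.

(** From e^(-1/2) >= 1 - 1/2 one gets e^(1/2) <= 2. *)
Lemma ln4_ge1 : 1 <= ln (4 : R).
Proof.
have -> : (4 : R) = 2 ^+ 2 by ring.
rewrite lnXn // -[leRHS]mulr_natl.
suff : 1 / 2 <= ln (2 : R) by lra.
rewrite -(expRK (1 / 2)) ler_ln ?posrE ?expR_gt0 //.
have := expR_ge1Dx (- (1 / 2) : R); rewrite expRN => h.
have e0 := expR_gt0 (1 / 2 : R).
have : (1 / 2) * expR (1 / 2) <= 1 :> R.
  rewrite -[leRHS](mulVf (lt0r_neq0 e0)); apply: ler_wpM2r; [exact: ltW | lra].
lra.
Qed.

(** Logarithm of [prime_count_lower] at n = floor(y), s = floor(sig). The factor 4^(2n/3) takes two
    thirds of the left-hand side, leaving n / 3. The free bounds [lam] and [sig] stand for log 2y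
    and sqrt(2y). *)
Lemma primes_between_lower y lam sig : 1 <= y -> ln (2 * y) <= lam -> 0 <= sig ->
  2 * y <= sig ^+ 2 -> (y - 1) / 3 <= ((size (primes_between y))%:R + sig + 1) * lam.
Proof.
move=> y1 Hlam sig0 Hsig; set N := size _.
have y0 : 0 <= y by lra.
pose n := Num.truncn y; pose s := Num.truncn sig.
have /andP[n1 n2] := truncn_itv y0; rewrite -/n in n1 n2.
have /andP[s1 s2] := truncn_itv sig0; rewrite -/s in s1 s2.
have n0 : (0 < n)%N by rewrite -ltnS -(ltr_nat R); apply: le_lt_trans n2.
have ns : (n.*2 < s.+1 ^ 2)%N.
  rewrite -(ltr_nat R) -muln2 natrM natrX; apply: le_lt_trans (_ : sig ^+ 2 < _).
    by apply: le_trans Hsig; lra.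
  by rewrite ltrXn2r // nnegrE.
have cN : (count (fun p => prime p && (n < p)) (iota 0 n.*2.+1) <= N)%N.
  rewrite -size_filter; apply: uniq_leq_size; first by rewrite filter_uniq ?iota_uniq.
  move=> p; rewrite mem_filter mem_iota mem_primes_between // add0n ltnS.
  move=> /andP[/andP[-> np] p2] /=; apply/andP; split.
    by apply: lt_le_trans n2 _; rewrite ler_nat.
  apply: le_trans (_ : n.*2%:R <= _); first by rewrite ler_nat.
  by rewrite -muln2 natrM mulrC; lra.
have n20 : (0 < n.*2)%N by rewrite double_gt0.
have P : (4 ^ n <= n.*2 ^ (N + s.+1) * 4 ^ (n.*2 %/ 3))%N.
  apply: leq_trans (prime_count_lower n0 ns) _; rewrite leq_mul2r; apply/orP; right.
  by rewrite leq_pexp2l // leq_add2r.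
have LP : n%:R * ln 4 <= (N + s.+1)%:R * ln (n.*2%:R) + (n.*2 %/ 3)%:R * ln (4 : R).
  have p4 k : 0 < (4 : R) ^+ k by rewrite exprn_gt0.
  have p2 k : 0 < (n.*2%:R : R) ^+ k by rewrite exprn_gt0 // ltr0n.
  have n2R : 0 < n.*2%:R :> R by rewrite ltr0n.
  rewrite !mulr_natl -!lnXn // -lnM ?posrE // ler_ln ?posrE ?mulr_gt0 //.
  by rewrite -!natrX -natrM ler_nat.
have d3 : (n.*2 %/ 3)%:R <= 2 / 3 * n%:R :> R.
  have := leq_divM n.*2 3; rewrite -(ler_nat R) natrM -muln2 natrM; lra.
have l2n : ln (n.*2%:R) <= lam.
  apply: le_trans Hlam; rewrite ler_ln ?posrE ?ltr0n //; last lra.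
  by rewrite -muln2 natrM; lra.
have l2n0 : 0 <= ln (n.*2%:R : R) by rewrite ln_ge0 // ler1n.
have ln4 := ln4_ge1.
have h1 : n%:R / 3 <= (N + s.+1)%:R * ln (n.*2%:R : R).
  have : (n.*2 %/ 3)%:R * ln (4 : R) <= 2 / 3 * n%:R * ln 4 by apply: ler_wpM2r => //; lra.
  have : n%:R / 3 * 1 <= n%:R / 3 * ln (4 : R) by apply: ler_wpM2l => //; rewrite divr_ge0.
  lra.
apply: le_trans (_ : n%:R / 3 <= _).
  by rewrite ler_pM2r ?invr_gt0 //; rewrite -natr1 in n2; lra.
apply: le_trans h1 _; apply: ler_pM => //.
by rewrite natrD -natr1 addrA lerD2r lerD2l.
Qed.

Definition primes_upto z : seq nat := [seq p <- iota 0 (Num.truncn z).+1 | prime p].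

Lemma mem_primes_upto z p : 0 <= z -> (p \in primes_upto z) = prime p && (p%:R <= z).
Proof.
move=> z0; rewrite mem_filter mem_iota /= add0n ltnS; congr (_ && _).
have /andP[h1 h2] := truncn_itv z0.
apply/idP/idP => h.
  by apply: le_trans h1; rewrite ler_nat.
by rewrite -ltnS -(ltr_nat R); apply: le_lt_trans h2.
Qed.

(** Logarithm of [prime_count_upper] at k = floor(sig) + 1, with ln 4 <= 3. *)
Lemma primes_upto_upper z sig : 0 <= z -> 1 <= sig ->
  ((size (primes_upto z))%:R - sig - 1) * ln sig <= 3 * z.
Proof.
move=> z0 sig1; pose k := (Num.truncn sig).+1; set m := Num.truncn z.
have sig0 : 0 <= sig by lra.
have /andP[k1 k2] := truncn_itv sig0; rewrite -/k in k2.
have /andP[m1 _] := truncn_itv z0; rewrite -/m in m1.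
have k0 : (0 < k)%N by [].
have := prime_count_upper m k0; rewrite -size_filter -/(primes_upto z).
set c := (_ - k)%N => P.
have l0 : 0 <= ln sig by exact: ln_ge0.
have hk : k%:R <= sig + 1 by rewrite -natr1 lerD2r.
have cs : (size (primes_upto z))%:R - sig - 1 <= c%:R.
  have : (size (primes_upto z) <= c + k)%N by rewrite /c; lia.
  by rewrite -(ler_nat R) natrD; lra.
apply: le_trans (_ : c%:R * ln sig <= _); first exact: ler_wpM2r.
have kp : 0 < k%:R :> R by rewrite ltr0n.
apply: le_trans (_ : c%:R * ln k%:R <= _).
  by apply: ler_wpM2l => //; rewrite ler_ln ?posrE //; [exact: ltW | lra].
apply: le_trans (_ : m%:R * ln 4 <= _).
  by rewrite !mulr_natl -!lnXn // ler_ln ?posrE ?exprn_gt0 // -!natrX ler_nat.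
have ln43 : ln (4 : R) <= 3.
  have -> : (4 : R) = 1 + 3 by ring.
  by apply: le_ln1Dx; lra.
rewrite mulrC; apply: ler_pM => //.
by apply: le_trans ln4_ge1.
Qed.

(** With t = ln x, the exponential series gives x >= t^(2k + 1) / (2k + 1)!, which is at least
    t^(2k) once t >= (2k + 1)!. *)
Lemma ln_pow_le_sqrt k (C : R) : exists x0 : R, forall x, x0 <= x ->
  [/\ 1 <= x, C <= ln x & ln x ^+ k <= Num.sqrt x].
Proof.
pose F : R := ((k * 2).+1)`!%:R.
exists (expR (Num.max 1 (Num.max C F))) => x Hx.
have x0 : 0 < x by apply: lt_le_trans Hx; exact: expR_gt0.
have : Num.max 1 (Num.max C F) <= ln x.
  by rewrite -[leLHS]expRK ler_ln ?posrE ?expR_gt0.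
rewrite !ge_max => /and3P[l1 lC lF].
have l0 : 0 <= ln x by lra.
have x1 : 1 <= x.
  by rewrite -(lnK (x := x)) ?posrE //; apply: le_trans (expR_ge1Dx _); lra.
split => //.
rewrite -(ler_pXn2r (_ : 0 < 2)%N) // ?nnegrE ?exprn_ge0 ?sqrtr_ge0 // sqr_sqrtr ?(ltW x0) //.
rewrite -exprM -{2}(lnK (x := x)) ?posrE //.
have Fp : 0 < F by rewrite ltr0n fact_gt0.
apply: le_trans (_ : ln x ^+ (k * 2).+1 / F <= _).
  by rewrite ler_pdivlMr // exprS mulrC ler_wpM2r ?exprn_ge0.
by have := expR_ge1Dxn (k * 2) l0; rewrite -/F; lra.
Qed.

End Analysis.

(** * Prime counts and the choice of moduli at the scales s = sqrt x and l = log x *)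

Section Scales.
Variable R : realType.
Implicit Types x s l : R.

(** Separates the scales l, s, s l and s^2 by linear inequalities, so that later comparisons are
    linear in these monomials. *)
Lemma scale_bounds s l : 10 ^+ 7 <= l -> l ^+ 13 <= s ->
  [/\ 100 <= l, 100 * 100 * l <= s, 10 * 100 * s <= s * l & 100 * 100 * (s * l) <= s ^+ 2].
Proof.
move=> l7 ls; have l100 : 100 <= l by apply: le_trans l7; lra.
have s_l : 100 * 100 * l <= s.
  apply: le_trans ls; rewrite exprSr ler_wpM2r //; first by lra.
  apply: le_trans (_ : l ^+ 2 <= _); first by nra.
  by rewrite ler_weXn2l //; lra.
split => //; first by rewrite mulrC ler_wpM2l //; lra.
have -> : 100 * 100 * (s * l) = s * (100 * 100 * l) by ring.
by rewrite expr2 ler_wpM2l //; lra.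
Qed.

Lemma exists_truncn (z : R) : 0 <= z -> exists n : nat, n%:R <= z < n.+1%:R.
Proof. by move=> /truncn_itv; exists (Num.truncn z). Qed.

(** From log 2x <= 2 l and 2x <= (2s)^2 the leading constant is 6; doubling it to 12 absorbs the
    lower order terms. *)
Lemma size_primes_between_x x s l : 1 <= x -> s ^+ 2 = x -> ln x = l ->
  100 <= l -> 100 * 100 * l <= s -> 10 * 100 * s <= s * l -> 100 * 100 * (s * l) <= s ^+ 2 ->
  s ^+ 2 <= 12 * l * (size (primes_between x))%:R.
Proof.
move=> x1 Es El l100 s_l sl_ge sl_s2.
have h1 : ln (2 * x) <= 2 * l.
  rewrite -El [leRHS]mulr_natl -lnXn; last by lra.
  have x4 : 2 <= x by rewrite -Es; lra.
  have [p1 p2] : 0 < 2 * x /\ 0 < x ^+ 2 by rewrite exprn_gt0; lra.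
  rewrite ler_ln ?posrE //.
  by rewrite expr2 ler_wpM2r //; lra.
have h2 : 0 <= 2 * s by lra.
have h3 : 2 * x <= (2 * s) ^+ 2 by rewrite exprMn Es; lra.
have := primes_between_lower x1 h1 h2 h3; rewrite -{1}Es.
move: (size _)%:R => N h.
have -> : 12 * l * N = 12 * (N * l) by ring.
move: h; have -> : (N + 2 * s + 1) * (2 * l) = 2 * (N * l) + 4 * (s * l) + 2 * l by ring.
move: (N * l) (s * l) (s ^+ 2) sl_ge sl_s2 => a b c *; lra.
Qed.

Lemma size_primes_between_y x s l : 1 <= x -> s ^+ 2 = x -> ln x = l ->
  100 <= l -> 100 * 100 * l <= s -> 10 * 100 * s <= s * l -> 100 * 100 * (s * l) <= s ^+ 2 ->
  s <= 4 * (size (primes_between (s * l)))%:R.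
Proof.
move=> x1 Es El l100 s_l sl_ge sl_s2.
have y1 : 1 <= s * l by lra.
have h1 : ln (2 * (s * l)) <= l.
  by rewrite -{2}El ler_ln ?posrE -?Es; lra.
(* Any [sig] somewhat below s / 12 would do, since s / 3 - [sig] must stay above s / 4; the value s
   / 32 is still far above sqrt(2 s l). *)
have h2 : 0 <= s / 32 by lra.
have h3 : 2 * (s * l) <= (s / 32) ^+ 2.
  by have -> : (s / 32) ^+ 2 = s ^+ 2 / (32 * 32) by [field]; lra.
have := primes_between_lower y1 h1 h2 h3; move: (size _)%:R => K h.
have : (s - 1) / 3 * l <= (K + s / 32 + 1) * l.
  by apply: le_trans h; rewrite mulrAC ler_pM2r ?invr_gt0 // mulrBl mul1r; lra.
rewrite ler_pM2r; lra.
Qed.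

(** With [sig] = s and ln s = l / 2 the main term is 24 s^2 / l, and one more s^2 / l absorbs the
    rest. *)
Lemma size_primes_upto_4x x s l : 1 <= x -> s ^+ 2 = x -> ln x = l ->
  100 <= l -> 100 * 100 * l <= s -> 10 * 100 * s <= s * l -> 100 * 100 * (s * l) <= s ^+ 2 ->
  (size (primes_upto (4 * x)))%:R <= 25 * (s ^+ 2 / l).
Proof.
move=> x1 Es El l100 s_l sl_ge sl_s2.
have z0 : 0 <= 4 * x by lra.
have s1 : 1 <= s by lra.
have := primes_upto_upper z0 s1; move: (size _)%:R => Q.
have -> : ln s = l / 2.
  have : ln x = ln s *+ 2 by rewrite -Es lnXn //; lra.
  by rewrite El mulr2n; lra.
rewrite -{1}Es => h.
rewrite mulrA ler_pdivlMr; last by lra.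
have E : (Q - s - 1) * (l / 2) = (Q * l) / 2 - (s * l) / 2 - l / 2 by field.
rewrite E in h; move: h sl_s2; move: (Q * l) (s * l) (s ^+ 2) sl_ge => a b c *; lra.
Qed.

(** The sieve bounds the sum of the variances, and [exists_two_small] then yields two moduli of
    small variance. *)
Lemma exists_equidistributed_moduli s l (A rs : seq nat) :
  10 ^+ 7 <= l -> l ^+ 13 <= s ->
  uniq A -> {in A, forall p, p%:R <= 2 * s ^+ 2} -> s ^+ 2 <= 12 * l * (size A)%:R ->
  uniq rs -> {in rs, forall r, prime r} ->
  {in rs, forall r, s * l < r%:R <= 2 * (s * l)} -> s <= 4 * (size rs)%:R ->
  exists r1 r2 : nat, [/\ r1 \in rs, r2 \in rs, r1 != r2 &
   forall r, r \in [:: r1; r2] ->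
     residue_variance R A r <= (size A)%:R ^+ 3 / (224 * s ^+ 2 * (s * l))].
Proof.
move=> l7 ls uA A2 HN urs prs rs2 HK.
have [l100 s_l sl_ge sl_s2] := scale_bounds l7 ls.
have s0 : 0 < s by lra.
have sl0 : 0 < s * l by lra.
have s20 : 0 < s ^+ 2 by rewrite exprn_gt0.
have N0 : 0 < (size A)%:R :> R.
  have l12 : 0 < 12 * l by lra.
  by rewrite -(pmulr_rgt0 _ l12); apply: lt_le_trans HN.
have v0 : 0 < (size A)%:R ^+ 3 / (224 * s ^+ 2 * (s * l)).
  apply: divr_gt0; first exact: exprn_gt0.
  exact: mulr_gt0 (mulr_gt0 (ltr0Sn _ 223) s20) sl0.
have xl1 : 1 <= s ^+ 2 * l ^+ 10.
  by rewrite mulr_ege1 // ?exprn_ege1 //; lra.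
(* Integer parts replace the real parameters: [L.+1] counts the translates, [X.+1] bounds A
   strictly, and [d.+1] is a lower bound for the moduli because r > s l >= d. *)
have [L /andP[L1 L2]] := exists_truncn (le_trans ler01 xl1).
have [X /andP[X1 X2]] : exists n : nat, n%:R <= 4 * s ^+ 2 < n.+1%:R.
  by apply: exists_truncn; lra.
have [d /andP[d1 d2]] := exists_truncn (ltW sl0).
have [D /andP[D1 D2]] : exists n : nat, n%:R <= 2 * (s * l) < n.+1%:R.
  by apply: exists_truncn; lra.
have AX : {in A, forall p, p < X.+1}%N.
  by move=> p /A2 p2; rewrite -(ltr_nat R); apply: le_lt_trans X2; lra.
have rsd : {in rs, forall r, d.+1 <= r <= D}%N.
  move=> r /rs2 /andP[r1 r2]; apply/andP; split.
    by rewrite -(ltr_nat R); apply: le_lt_trans r1.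
  by rewrite -ltnS -(ltr_nat R); apply: le_lt_trans D2.
have L3 : L.+1%:R <= 2 * s ^+ 2 * l ^+ 10 by rewrite -(natr1 L) -mulrA; lra.
have X3 : X.+1%:R <= 5 * s ^+ 2 by rewrite -(natr1 X); lra.
have M1 : ((L.+1 + X.+1) %/ d.+1).+1%:R <= (L.+1%:R + X.+1%:R) / (s * l) + 1.
  rewrite -(natr1 (_ %/ _)) lerD2r ler_pdivlMr // -natrD.
  apply: le_trans (_ : ((L.+1 + X.+1) %/ d.+1 * d.+1)%:R <= _).
    by rewrite natrM ler_wpM2l // ltW.
  by rewrite ler_nat leq_divM.
have Tlt : \sum_(r <- rs) residue_variance R A r <
    ((size rs)%:R - 1) * ((size A)%:R ^+ 3 / (224 * s ^+ 2 * (s * l))).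
  apply: (sieve_threshold s0 l7 ls HN HK (ltW L2) L3 X3 M1 (ler0n _ _) D1).
  exact: (@variance_sieve R A rs L.+1 X.+1 d.+1 D _ uA AX urs prs isT rsd erefl).
have [r1 [r2 [r1rs r2rs r12 V1 V2]]] := exists_two_small urs v0 (residue_variance_ge0 R A) Tlt.
by exists r1, r2; split => // r; rewrite !inE => /orP[] /eqP ->.
Qed.

End Scales.

(** * Assembly of the estimates *)

Theorem theorem1 (R : realType) :
  exists c1 x0 : R, 0 < c1 /\
    forall x : R, x0 <= x ->
      exists r1 r2 q : nat,
        [/\ [/\ prime r1, prime r2 & prime q],
            [/\ r1 != r2, r1 != q & r2 != q],
            (Num.sqrt x * ln x < r1%:R <= 2 * (Num.sqrt x * ln x)) /\
            (Num.sqrt x * ln x < r2%:R <= 2 * (Num.sqrt x * ln x)),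
            q%:R <= 4 * x &
            C3 (r1 * r2 * q)%N /\
            exists2 S : seq nat,
              uniq S /\ c1 * (x / ln x ^+ 4) <= (size S)%:R &
              forall m : nat, m \in S ->
                C3_parent (r1 * r2 * q)%N m /\
                exists p1 p2 p3 : nat,
                  [/\ [/\ prime p1, prime p2 & prime p3],
                      [/\ x < p1%:R <= 2 * x, x < p2%:R <= 2 * x &
                          x < p3%:R <= 2 * x] &
                      m = (p1 * p2 * p3)%N]].
Proof.
(* The exponent 13 and the bound 10^7 are those required by [sieve_threshold]. *)
have [x0 Hx0] := @ln_pow_le_sqrt R 13 (10 ^+ 7).
exists (1 / 10 ^+ 8), x0; split; first by rewrite divr_gt0 // exprn_gt0.
move=> x /Hx0 [x1]; have Es : Num.sqrt x ^+ 2 = x by rewrite sqr_sqrtr //; exact: le_trans x1.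
move El: (ln x) => l; move: (Num.sqrt x) Es => s Es l7 ls.
have [l100 s_l sl_ge sl_s2] := scale_bounds l7 ls.
have s0 : 0 < s by lra.
have l0 : 0 < l by lra.
have sl0 : 0 < s * l by lra.
have s20 : 0 < s ^+ 2 by rewrite exprn_gt0.
have HN := size_primes_between_x x1 Es El l100 s_l sl_ge sl_s2.
have HK := size_primes_between_y x1 Es El l100 s_l sl_ge sl_s2.
have HQ := size_primes_upto_4x x1 Es El l100 s_l sl_ge sl_s2.
have mA p : (p \in primes_between x) = prime p && (x < p%:R <= 2 * x).
  by apply: mem_primes_between; lra.
have mrs p : (p \in primes_between (s * l)) = prime p && (s * l < p%:R <= 2 * (s * l)).
  by apply: mem_primes_between; lra.
have mQ p : (p \in primes_upto (4 * x)) = prime p && (p%:R <= 4 * x).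
  by apply: mem_primes_upto; lra.
have uA : uniq (primes_between x) by rewrite filter_uniq ?iota_uniq.
have urs : uniq (primes_between (s * l)) by rewrite filter_uniq ?iota_uniq.
have uQ : uniq (primes_upto (4 * x)) by rewrite filter_uniq ?iota_uniq.
move: (primes_between x) (primes_between (s * l)) (primes_upto (4 * x))
  HN HK HQ mA mrs mQ uA urs uQ => A rs Qs HN HK HQ mA mrs mQ uA urs uQ.
have N0 : (0 < size A)%N.
  rewrite -(ltr_nat R); have l12 : 0 < 12 * l by lra.
  by rewrite -(pmulr_rgt0 _ l12); apply: lt_le_trans HN.
have [r1 [r2 [r1rs r2rs r12 Hvar]]] : exists r1 r2 : nat, [/\ r1 \in rs, r2 \in rs, r1 != r2 &
   forall r, r \in [:: r1; r2] ->
     residue_variance R A r <= (size A)%:R ^+ 3 / (224 * s ^+ 2 * (s * l))].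
  apply: exists_equidistributed_moduli => //.
  - by move=> p; rewrite mA Es => /and3P[].
  - by move=> r; rewrite mrs => /andP[].
  - by move=> r; rewrite mrs => /andP[].
(* X = floor(4x), so [X.+1] exceeds every sum of two elements of A and is still at most 5x. *)
have [X /andP[X1 X2]] : exists n : nat, n%:R <= 4 * s ^+ 2 < n.+1%:R.
  by apply: exists_truncn; lra.
have X5 : X.+1%:R <= 5 * s ^+ 2 by rewrite -(natr1 X); lra.
have AX : {in A, forall p, p.*2 < X.+1}%N.
  move=> p; rewrite mA => /and3P[_ _ p2]; rewrite -(ltr_nat R); apply: le_lt_trans X2.
  by rewrite -muln2 natrM Es; lra.
have AX' : {in A, forall p, p < X.+1}%N.
  by move=> p /AX; apply: leq_ltn_trans; rewrite -addnn leq_addr.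
have rsP r : r \in rs -> [/\ prime r, s * l < r%:R, r%:R <= 2 * (s * l) & 0 < r%:R :> R].
  by rewrite mrs => /and3P[pr h1 h2]; split => //; apply: lt_trans h1.
have [pr1 r1l r1u r1p] := rsP _ r1rs; have [pr2 r2l r2u r2p] := rsP _ r2rs.
have quo r : (0 < r)%N -> (X.+1 %/ r)%:R * r%:R <= X.+1%:R :> R.
  by move=> r0; rewrite -natrM ler_nat leq_divM.
have HT : (size A)%:R ^+ 3 / (8 * r1%:R * r2%:R) <= (size (divisor_triples A r1 r2))%:R :> R.
  apply: pair_count; rewrite ?(prime_gt0 pr1) ?(prime_gt0 pr2) // => r rr.
  have [pr rl ru rp] : [/\ prime r, s * l < r%:R, r%:R <= 2 * (s * l) & 0 < r%:R :> R].
    by move: rr; rewrite !inE => /orP[] /eqP ->; exact: rsP.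
  apply: le_trans (sum_sqr_oppcount_le R (prime_gt0 pr) uA AX') _.
  rewrite -natr1.
  apply: (variance_small_enough s0 _ _ _ X5 rp ru (ler0n _ _) (quo _ (prime_gt0 pr)) (residue_variance_ge0 R A r) (Hvar _ rr)).
  - lra.
  - lra.
  - by rewrite ltr0n.
have c0 : 0 <= 1 / 10 ^+ 8 * (s ^+ 2 / l ^+ 4).
  by rewrite mulr_ge0 // divr_ge0 // ?exprn_ge0 // ltW.
(* m is the integer part of c1 x / log^4 x; having more than m parents means having at least m + 1,
   which exceeds the real bound. *)
have [m /andP[m1 m2]] := exists_truncn c0.
have enough := enough_triples s0 l7 ls HN X5 r1l r1u r2l r2u (quo _ (prime_gt0 pr1))
  (quo _ (prime_gt0 pr2)) (ler0n _ _) (ler0n _ _) (ler0n _ m) m1 (ler0n _ _) HQ HT.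
rewrite !natr1 -!natrM -!natrD ltr_nat in enough.
have big r r' : s * l < r%:R -> s * l < r'%:R -> (X.+1 <= r * r')%N.
  move=> h h'; rewrite -(ler_nat R) natrM; apply: le_trans X5 _.
  apply: le_trans (_ : (s * l) * (s * l) <= _); last by apply: ler_pM => //; exact: ltW.
  have -> : 5 * s ^+ 2 = (5 * s) * s by ring.
  have -> : (s * l) * (s * l) = (s * l * l) * s by ring.
  rewrite ler_pM2r //; apply: le_trans (_ : s * l <= _); first by lra.
  by rewrite ler_peMr //; lra.
have [||||||||q [S [qQ pq r1q r2q [uS mS HS]]]] :=
  @many_parents A r1 r2 X.+1 uA _ pr1 pr2 r12 _ _ _ AX _ _ _ Qs m uQ _ enough.
- by move=> p; rewrite mA => /andP[].
- by rewrite -(ltr_nat R); lra.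
- by rewrite -(ltr_nat R); lra.
- move=> p; rewrite mA => /and3P[_ px _].
  have h r : r%:R <= 2 * (s * l) -> (r < p)%N.
    by move=> ru; rewrite -(ltr_nat R); lra.
  by rewrite gtn_max !h.
- by rewrite -mulnn; exact: big.
- by rewrite -mulnn; exact: big.
- exact: big.
- move=> p p'; rewrite !mA => /and3P[pp px p2] /and3P[pp' px' p2'].
  have g1 : (1 < p + p')%N by apply: leq_trans (prime_gt1 pp) (leq_addr _ _).
  rewrite mQ max_pdiv_prime //=; apply: le_trans (_ : (p + p')%:R <= _).
    by rewrite ler_nat dvdn_leq ?max_pdiv_dvd // ltnW.
  by rewrite natrD; lra.
have C3n : C3 (r1 * r2 * q) by exists r1, r2, q.
exists r1, r2, q; split => //.
- by rewrite r1l r2l.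
- by move: qQ; rewrite mQ => /andP[].
split => //; exists S.
  split => //; rewrite -Es; apply: le_trans (ltW m2) _; by rewrite ler_nat.
move=> n /HS [wn [p1 [p2 [p3 [[p1A p2A p3A] [n12 n13 n23] En]]]]].
move: p1A p2A p3A; rewrite !mA => /andP[pp1 p1x] /andP[pp2 p2x] /andP[pp3 p3x].
have C3m : C3 n by exists p1, p2, p3.
split; last by exists p1, p2, p3.
by split => //; split => //; left.
Qed.
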